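(* Let $A$ be a $C^*$-algebra. Then $\ker T_A$ is the largest weakly central ideal of $A$; that is, $\ker T_A$ is a weakly central ideal of $A$ and it contains every weakly central ideal of $A$.
   Context: $A$ is not assumed unital. ''Ideal'' means closed two-sided ideal; $Z(A)$ is the centre of $A$. An ideal $I$ is modular if $A/I$ is unital; $\mathrm{Max}(A)$ denotes the set of all modular maximal (proper) ideals of $A$. A $C^*$-algebra $A$ is weakly central if (a) no $M\in\mathrm{Max}(A)$ contains $Z(A)$, and (b) for all $M_1,M_2\in\mathrm{Max}(A)$, $M_1\cap Z(A)=M_2\cap Z(A)$ implies $M_1=M_2$. An ideal is weakly central if it is weakly central as a $C^*$-algebra. $T_A^1$ is the set of all $M\in\mathrm{Max}(A)$ with $Z(A)\subseteq M$. $T_A^2$ is the set of all $M\in\mathrm{Max}(A)$ for which there exists $N\in\mathrm{Max}(A)$ such that $M\neq N$, $Z(A)\nsubseteq M$, $Z(A)\nsubseteq N$ and $M\cap Z(A)=N\cap Z(A)$. $T_A:=T_A^1\cup T_A^2$. $\ker T_A$ is the intersection of all elements of $T_A$, with $\ker\emptyset=A$. *)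

(* Defs.v *)
From HB Require Import structures.
From mathcomp Require Import all_boot all_order all_algebra.
From mathcomp Require Import complex.
From mathcomp Require Import all_classical all_reals all_analysis.
Set Implicit Arguments.
Unset Strict Implicit.
Unset Printing Implicit Defensive.
Import Order.TTheory GRing.Theory Num.Theory.
Import numFieldNormedType.Exports.
Local Open Scope classical_set_scope.
Local Open Scope ring_scope.

(* MathComp rings have a 1, so the product of a possibly non-unital algebra is
   an additional operation on a complex Banach space.  The norm takes its
   values in the nonnegative real elements of R[i]. *)
HB.mixin Record BanachSpace_isCstarAlgebra (R : realType) A
    of CompleteNormedModule R[i] A := {
  cmul : A -> A -> A;
  adj : A -> A;
  cmulA : forall x y z : A, cmul x (cmul y z) = cmul (cmul x y) z;
  cmulDl : forall x y z : A, cmul (x + y) z = cmul x z + cmul y z;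
  cmulDr : forall x y z : A, cmul x (y + z) = cmul x y + cmul x z;
  cmulZl : forall (k : R[i]) (x y : A), cmul (k *: x) y = k *: cmul x y;
  cmulZr : forall (k : R[i]) (x y : A), cmul x (k *: y) = k *: cmul x y;
  norm_cmul : forall x y : A, `|cmul x y| <= `|x| * `|y|;
  adjD : forall x y : A, adj (x + y) = adj x + adj y;
  adjZ : forall (k : R[i]) (x : A), adj (k *: x) = Num.conj k *: adj x;
  adjM : forall x y : A, adj (cmul x y) = cmul (adj y) (adj x);
  adjK : forall x : A, adj (adj x) = x;
  cstar_identity : forall x : A, `|cmul (adj x) x| = `|x| ^+ 2
}.

#[short(type="cstarAlgType")]
HB.structure Definition CstarAlgebra (R : realType) :=
  {A of BanachSpace_isCstarAlgebra R A & CompleteNormedModule R[i] A}.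

Reserved Notation "x ** y" (at level 40, left associativity).
Notation "x ** y" := (cmul x y) : ring_scope.

(* The notions below are relative to a C*-subalgebra B of A; B = setT gives
   those of A itself, and B an ideal of A gives those of this ideal regarded
   as a C*-algebra.  As B is closed, closedness in B and in A agree. *)
Section RelativeNotions.
Context {R : realType} {A : cstarAlgType R}.
Implicit Types B I M N : set A.

Definition center B : set A :=
  [set z | B z /\ forall b, B b -> z ** b = b ** z].

Record ideal B I : Prop := Ideal {
  ideal_sub : I `<=` B;
  ideal0 : I 0;
  idealD : forall x y, I x -> I y -> I (x + y);
  idealZ : forall (k : R[i]) x, I x -> I (k *: x);
  ideal_mull : forall b x, B b -> I x -> I (b ** x);
  ideal_mulr : forall x b, I x -> B b -> I (x ** b);
  ideal_closed : closed I
}.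

Definition coset I (a : A) : set A := [set a + x | x in I].

(* B / I has a unit e + I; its product is (a + I) (b + I) = a ** b + I. *)
Definition quotient_unital B I : Prop :=
  exists2 e, B e & forall b, B b ->
    coset I (e ** b) = coset I b /\ coset I (b ** e) = coset I b.

Definition modular B I : Prop := ideal B I /\ quotient_unital B I.

Definition maximal_ideal B M : Prop :=
  [/\ ideal B M, M <> B &
      forall J, ideal B J -> M `<=` J -> J <> B -> J = M].

Definition Max B : set (set A) := [set M | modular B M /\ maximal_ideal B M].

Definition weakly_central B : Prop :=
  (forall M, Max B M -> ~ center B `<=` M) /\
  (forall M1 M2, Max B M1 -> Max B M2 ->
     M1 `&` center B = M2 `&` center B -> M1 = M2).

End RelativeNotions.

Section TA.
Context {R : realType} (A : cstarAlgType R).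

Definition weakly_central_ideal (I : set A) : Prop :=
  ideal setT I /\ weakly_central I.

Definition TA1 : set (set A) :=
  [set M | Max setT M /\ center setT `<=` M].

Definition TA2 : set (set A) :=
  [set M | Max setT M /\
    exists N : set A, Max setT N /\
      [/\ M <> N, ~ center setT `<=` M, ~ center setT `<=` N &
          M `&` center setT = N `&` center setT]].

Definition TA : set (set A) := TA1 `|` TA2.

(* An empty \bigcap is setT. *)
Definition ker_TA : set A := \bigcap_(M in TA) M.

End TA.

Arguments TA1 {R} A _.
Arguments TA2 {R} A _.
Arguments TA {R} A _.
Arguments ker_TA {R} A _.

(* Main.v *)
(* If M is maximal modular and does not contain an ideal I then M /\ I is
   maximal modular in I, and every maximal modular ideal of I arises from
   exactly one such M; moreover Z(I) = Z(A) /\ I.  So weak centrality of I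
   is a statement about the traces on Z(A) /\ I of the M in Max(A) that do not
   contain I.  Everything but one point is then formal: for M outside T_A not
   containing J = ker T_A, some element of Z(A) /\ J lies outside M.  Otherwise
   localize at M: the a with s a in J for some central s outside M form a
   proper modular ideal, and a maximal ideal M' above it contains J and every
   central z annihilated by some central s outside M.  Such z are dense in
   M /\ Z(A), so M and M' have the same trace on Z(A), which puts M in T_A.

   Gelfand theory is replaced by explicit elements.  For h = z*z the functions
   (h^2 - d^2)_+ and (d^2 - h^2)_+ are polynomials in h and an absolute value;
   square roots come from the monotone iteration for 1 - sqrt(T), and all norm
   estimates from |T*T| = |T|^2 applied to elements whose real or imaginary
   part is the one to be bounded. *)
Require Import Defs.
From HB Require Import structures.
From mathcomp Require Import all_boot all_order all_algebra.
From mathcomp Require Import ring lra complex.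
From mathcomp Require Import all_classical all_reals all_analysis.
(* Reimported because MathComp has its own [center]. *)
Import Defs.
Set Implicit Arguments.
Unset Strict Implicit.
Unset Printing Implicit Defensive.
Import Order.TTheory GRing.Theory Num.Theory.
Import numFieldNormedType.Exports.
Local Open Scope classical_set_scope.
Local Open Scope ring_scope.

(** * Elementary algebra and norm facts in a possibly non-unital C*-algebra *)

Section Basics.
Context {R : realType} {A : cstarAlgType R}.
Implicit Types (x y z a b : A) (k : R[i]).

Lemma cmul0x x : 0 ** x = 0.
Proof. by apply: (addIr (0 ** x)); rewrite -cmulDl !add0r. Qed.

Lemma cmulx0 x : x ** 0 = 0.
Proof. by apply: (addIr (x ** 0)); rewrite -cmulDr !add0r. Qed.

Lemma cmulNx x y : (- x) ** y = - (x ** y).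
Proof. by apply: (addrI (x ** y)); rewrite -cmulDl !subrr cmul0x. Qed.

Lemma cmulxN x y : x ** (- y) = - (x ** y).
Proof. by apply: (addrI (x ** y)); rewrite -cmulDr !subrr cmulx0. Qed.

Lemma cmulBl x y z : (x - y) ** z = x ** z - y ** z.
Proof. by rewrite cmulDl cmulNx. Qed.

Lemma cmulBr x y z : x ** (y - z) = x ** y - x ** z.
Proof. by rewrite cmulDr cmulxN. Qed.

Lemma adj0 : adj (0 : A) = 0.
Proof. by apply: (addIr (adj 0)); rewrite -adjD !add0r. Qed.

Lemma adjN x : adj (- x) = - adj x.
Proof. by apply: (addrI (adj x)); rewrite -adjD !subrr adj0. Qed.

Lemma norm_adj x : `|adj x| = `|x|.
Proof.
have le y : `|y| <= `|adj y|.
  have [->|y0] := eqVneq y 0; first by rewrite adj0.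
  have y_gt0 : 0 < `|y| by rewrite normr_gt0.
  by rewrite -(ler_pM2r y_gt0) -expr2 -cstar_identity norm_cmul.
by apply/le_anti; rewrite le andbT -{2}(adjK x) le.
Qed.

Lemma normC_small (c : R[i]) : 0 <= c -> (forall e, 0 < e -> c <= e) -> c = 0.
Proof.
move=> c0 H; apply/eqP; apply/negPn/negP => cN0.
have c_gt0 : 0 < c by rewrite lt_def cN0.
have /H : 0 < c / 2 by rewrite divr_gt0.
by rewrite ler_pdivlMr // mulr_natr mulr2n gerDl => /(lt_le_trans c_gt0); rewrite ltxx.
Qed.

Lemma closed_normP (K : set A) : closed K <->
  forall x, (forall e : R[i], 0 < e -> exists2 y, K y & `|x - y| < e) -> K x.
Proof.
split=> [cK x H|H].
  rewrite ((closure_id K).1 cK) => B /nbhs_ballP[e /= e0 eB].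
  have [y Ky xy] := H e e0; exists y; split => //.
  by apply: eB; rewrite -ball_normE.
apply/closure_id; apply/seteqP; split; first exact: subset_closure.
move=> x clx; apply: H => e e0.
have [y [Ky yb]] := clx _ (nbhsx_ballx x e e0).
by exists y => //; move: yb; rewrite -ball_normE.
Qed.

(** The error bound [d] survives in the limit, so later limits are handled by numerical estimates
    alone. *)
Lemma complete_limit (u : nat -> A) (d : nat -> R[i]) :
  (forall m n, (n <= m)%N -> `|u m - u n| <= d n) ->
  (forall e, 0 < e -> exists n, d n < e) ->
  exists l, (forall n, `|l - u n| <= d n) /\
    forall e, 0 < e -> exists n, `|l - u n| < e.
Proof.
move=> Hu Hd.
have cu : cvg (u @ \oo).
  apply/cauchy_cvgP/cauchy_exP => e e0.
  have [n dn] := Hd e e0; exists (u n); exists n => // m /= nm.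
  by rewrite -ball_normE /= distrC (le_lt_trans (Hu _ _ nm)).
have lu n : `|lim (u @ \oo) - u n| <= d n.
  apply/ler_addgt0Pr => e e0.
  have /cvgrPdist_lt /(_ e e0) [N _ HN] := cu.
  have /= := HN (maxn n N) (leq_maxr _ _) => H1.
  have H2 := Hu (maxn n N) n (leq_maxl _ _).
  rewrite -(subrK (u (maxn n N)) (lim (u @ \oo))) -addrA.
  by rewrite (le_trans (ler_normD _ _)) // (addrC (d n)) lerD // ltW.
exists (lim (u @ \oo)); split => // e /Hd[n dn].
by exists n; exact: le_lt_trans dn.
Qed.

End Basics.

(** * The unitization of the centre and its action on A *)

Section UnitizedCentre.
Context {R : realType} {A : cstarAlgType R}.

Definition central (z : A) := forall b, z ** b = b ** z.

Lemma centerT z : center setT z <-> central z.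
Proof. by split=> [[_ h] b|h]; [exact: h|split]. Qed.

Lemma central0 : central 0.
Proof. by move=> b; rewrite cmul0x cmulx0. Qed.

Lemma centralD z w : central z -> central w -> central (z + w).
Proof. by move=> hz hw b; rewrite cmulDl cmulDr hz hw. Qed.

Lemma centralN z : central z -> central (- z).
Proof. by move=> hz b; rewrite cmulNx cmulxN hz. Qed.

Lemma centralZ k z : central z -> central (k *: z).
Proof. by move=> hz b; rewrite cmulZl cmulZr hz. Qed.

Lemma centralM z w : central z -> central w -> central (z ** w).
Proof. by move=> hz hw b; rewrite -cmulA hw cmulA hz cmulA. Qed.

Lemma central_adj z : central z -> central (adj z).
Proof. by move=> hz b; rewrite -[b]adjK -!adjM hz. Qed.

(* The unital commutative *-algebra C (+) Z(A): the element (k, z) acts on A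
   by a |-> k a + z a. *)
Record ucenter := UCenter {
  scal : R[i]; elt : A; elt_central : central elt }.

Lemma ucenter_eq T S : scal T = scal S -> elt T = elt S -> T = S.
Proof.
case: T S => [k z hz] [l w hw] /= -> zw; subst w.
by congr UCenter; exact: Prop_irrelevance.
Qed.

HB.instance Definition _ := gen_eqMixin ucenter.
HB.instance Definition _ := gen_choiceMixin ucenter.

Definition uc0 := UCenter 0 central0.
Definition uc1 := UCenter 1 central0.
Definition ucN T := UCenter (- scal T) (centralN (elt_central T)).
Definition ucD T S :=
  UCenter (scal T + scal S) (centralD (elt_central T) (elt_central S)).
Definition ucM T S := UCenter (scal T * scal S)
  (centralD (centralD (centralZ (scal T) (elt_central S))
                      (centralZ (scal S) (elt_central T)))
            (centralM (elt_central T) (elt_central S))).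

Fact ucDA : associative ucD.
Proof. by move=> T S V; apply: ucenter_eq; rewrite /= addrA. Qed.
Fact ucDC : commutative ucD.
Proof. by move=> T S; apply: ucenter_eq; rewrite /= addrC. Qed.
Fact uc0D : left_id uc0 ucD.
Proof. by move=> T; apply: ucenter_eq; rewrite /= add0r. Qed.
Fact ucND : left_inverse uc0 ucN ucD.
Proof. by move=> T; apply: ucenter_eq; rewrite /= addNr. Qed.

HB.instance Definition _ := GRing.isZmodule.Build ucenter ucDA ucDC uc0D ucND.

Fact ucMA : associative ucM.
Proof.
move=> T S V; apply: ucenter_eq; rewrite /= ?mulrA //.
rewrite !scalerDr !cmulDl !cmulDr !cmulZl !cmulZr !scalerA cmulA.
rewrite (mulrC (scal V) (scal T)) (mulrC (scal V) (scal S)) !addrA.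
by rewrite [RHS](ACl (1*2*5*3*6*4*7)).
Qed.
Fact ucMC : commutative ucM.
Proof.
move=> T S; apply: ucenter_eq; rewrite /= 1?mulrC //.
by rewrite (elt_central T) (addrC (_ *: elt S)).
Qed.
Fact uc1M : left_id uc1 ucM.
Proof.
move=> T; apply: ucenter_eq; rewrite /= ?mul1r //.
by rewrite scale1r scaler0 cmul0x !addr0.
Qed.
Fact ucMD : left_distributive ucM ucD.
Proof.
move=> T S V; apply: ucenter_eq; rewrite /= ?mulrDl //.
rewrite !scalerDl scalerDr cmulDl !addrA.
by rewrite [RHS](ACl (1*4*2*5*3*6)).
Qed.
Fact uc1N0 : uc1 != 0.
Proof. by apply/eqP => /(congr1 scal)/= /eqP; rewrite oner_eq0. Qed.

HB.instance Definition _ :=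
  GRing.Zmodule_isComNzRing.Build ucenter ucMA ucMC uc1M ucMD uc1N0.

Implicit Types (T S V : ucenter) (c d : R[i]).

Lemma scalD T S : scal (T + S) = scal T + scal S. Proof. by []. Qed.
Lemma scalN T : scal (- T) = - scal T. Proof. by []. Qed.
Lemma scalM T S : scal (T * S) = scal T * scal S. Proof. by []. Qed.

Definition scalar k := UCenter k central0.

Lemma scalarD k l : scalar (k + l) = scalar k + scalar l.
Proof. by apply: ucenter_eq; rewrite //= addr0. Qed.
Lemma scalarN k : scalar (- k) = - scalar k.
Proof. by apply: ucenter_eq; rewrite //= oppr0. Qed.
Lemma scalarM k l : scalar (k * l) = scalar k * scalar l.
Proof. by apply: ucenter_eq; rewrite //= !scaler0 cmul0x !addr0. Qed.
Lemma scalar_half : scalar 2^-1 + scalar 2^-1 = 1.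
Proof. by rewrite -scalarD -[2^-1]mul1r -splitr. Qed.

Definition of_central z (hz : central z) := UCenter 0 hz.

Definition ustar T := UCenter (Num.conj (scal T)) (central_adj (elt_central T)).

Lemma ustarK T : ustar (ustar T) = T.
Proof. by apply: ucenter_eq; rewrite /= ?conjCK ?adjK. Qed.
Lemma ustarD T S : ustar (T + S) = ustar T + ustar S.
Proof. by apply: ucenter_eq; rewrite /= ?rmorphD ?adjD. Qed.
Lemma ustarN T : ustar (- T) = - ustar T.
Proof. by apply: ucenter_eq; rewrite /= ?rmorphN ?adjN. Qed.
Lemma ustarM T S : ustar (T * S) = ustar T * ustar S.
Proof.
apply: ucenter_eq; rewrite /= ?rmorphM // !adjD !adjZ adjM.
by rewrite (central_adj (elt_central T)).
Qed.
Lemma ustar_scalar k : ustar (scalar k) = scalar (Num.conj k).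
Proof. by apply: ucenter_eq; rewrite //= adj0. Qed.
Lemma ustar1 : ustar 1 = 1.
Proof. by rewrite -[1]/(scalar 1) ustar_scalar rmorph1. Qed.

Definition act T a := scal T *: a + elt T ** a.

Lemma actD T S a : act (T + S) a = act T a + act S a.
Proof. by rewrite /act /= scalerDl cmulDl addrACA. Qed.
Lemma actN T a : act (- T) a = - act T a.
Proof. by rewrite /act /= scaleNr cmulNx opprD. Qed.
Lemma actM T S a : act (T * S) a = act T (act S a).
Proof.
rewrite /act /= !cmulDl !cmulDr !cmulZl !cmulZr scalerDr scalerA -!addrA.
by congr (_ + (_ + (_ + _))); rewrite cmulA.
Qed.
Lemma act_scalar k a : act (scalar k) a = k *: a.
Proof. by rewrite /act /= cmul0x addr0. Qed.
Lemma act_of_central z (hz : central z) a : act (of_central hz) a = z ** a.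
Proof. by rewrite /act /= scale0r add0r. Qed.
Lemma act_cmul T a b : act T (a ** b) = act T a ** b.
Proof. by rewrite /act cmulDl cmulZl cmulA. Qed.
Lemma act_cmulr T a b : act T (a ** b) = a ** act T b.
Proof. by rewrite /act cmulDr cmulZr !cmulA elt_central. Qed.
Lemma adj_act T a : adj (act T a) = act (ustar T) (adj a).
Proof. by rewrite /act adjD adjZ adjM (central_adj (elt_central T)). Qed.

Lemma act_adjoint T a : adj (act T a) ** act T a = adj a ** act (ustar T * T) a.
Proof. by rewrite adj_act -act_cmul act_cmulr actM. Qed.

(** The norm being bounded is the maximum of |scal T| and the operator norm of T on A. The scalar
    part is included because the action alone is not faithful for unital A, where (1, -1) acts as
    zero. *)
Definition bnd T c := `|scal T| <= c /\ forall a, `|act T a| <= c * `|a|.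

Lemma bnd_ge0 T c : bnd T c -> 0 <= c.
Proof. by case=> h _; exact: le_trans h. Qed.

Lemma bndD T S c d : bnd T c -> bnd S d -> bnd (T + S) (c + d).
Proof.
move=> [Tc hT] [Sd hS]; split=> [|a].
  by rewrite (le_trans (ler_normD _ _)) // lerD.
by rewrite actD mulrDl (le_trans (ler_normD _ _)) // lerD.
Qed.

Lemma bndN T c : bnd T c -> bnd (- T) c.
Proof.
by move=> [Tc hT]; split=> [|a]; rewrite ?actN ?scalN normrN.
Qed.

Lemma bndB T S c d : bnd T c -> bnd S d -> bnd (T - S) (c + d).
Proof. by move=> bT bS; apply: bndD => //; exact: bndN. Qed.

Lemma bndM T S c d : bnd T c -> bnd S d -> bnd (T * S) (c * d).
Proof.
move=> bT; have c0 := bnd_ge0 bT; case: bT => [Tc hT] [Sd hS]; split=> [|a].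
  by rewrite scalM normrM ler_pM.
by rewrite actM (le_trans (hT _)) // -mulrA ler_wpM2l.
Qed.

Lemma bnd_scalar k c : `|k| <= c -> bnd (scalar k) c.
Proof. by move=> kc; split=> // a; rewrite act_scalar normrZ ler_wpM2r. Qed.

Lemma bnd1 : bnd 1 1.
Proof. by apply: (@bnd_scalar 1); rewrite normr1. Qed.

Lemma bnd0 : bnd 0 0.
Proof. by apply: (@bnd_scalar 0); rewrite normr0. Qed.

Lemma bnd_of_central z (hz : central z) c : `|z| <= c -> bnd (of_central hz) c.
Proof.
move=> zc; split=> [|a]; first by rewrite normr0 (le_trans _ zc).
by rewrite act_of_central (le_trans (norm_cmul _ _)) // ler_wpM2r.
Qed.

Lemma bnd_le T c d : bnd T c -> c <= d -> bnd T d.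
Proof.
move=> [Tc hT] cd; split=> [|a]; first exact: le_trans cd.
by rewrite (le_trans (hT a)) // ler_wpM2r.
Qed.

Lemma bnd_lim T c : (forall e, 0 < e -> bnd T (c + e)) -> bnd T c.
Proof.
move=> H; split=> [|a]; apply/ler_addgt0Pr => e e0; first by case: (H e e0).
have [|_ /(_ a)] := H (e / (`|a| + 1)).
  by rewrite divr_gt0 // ltr_wpDl.
move/le_trans; apply; rewrite mulrDl lerD2l mulrAC ler_pdivrMr ?ltr_wpDl//.
by rewrite ler_pM2l // lerDl.
Qed.

(** Once the scalar part vanishes, z = [elt T] satisfies z ** adj z = act T (adj z) = 0, and the
    C*-identity gives z = 0. *)
Lemma bnd_eq0 T : (forall e, 0 < e -> bnd T e) -> T = 0.
Proof.
move=> H; have [|s0 a0] := @bnd_lim T 0; first by move=> e /H; rewrite add0r.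
have sT : scal T = 0 by apply/eqP; rewrite -normr_le0.
apply: ucenter_eq => //=; apply/eqP; rewrite -[elt T]adjK -normr_eq0 norm_adj.
have := a0 (adj (elt T)); rewrite mul0r /act sT scale0r add0r normr_le0.
rewrite -{1}[elt T]adjK -normr_eq0 cstar_identity expf_eq0 /=.
by rewrite normr_eq0.
Qed.

(** With z = [elt T] and k = [scal T], evaluating T at adj z gives |z|^2 = |T(adj z) - k adj z| <=
    (c + |k|) |z|. *)
Lemma norm_elt T c : bnd T c -> `|elt T| <= c + `|scal T|.
Proof.
move=> bT; have c0 := bnd_ge0 bT; case: bT => _ hT.
have [->|z0] := eqVneq (elt T) 0; first by rewrite normr0 addr_ge0.
have zp : 0 < `|elt T| by rewrite normr_gt0.
rewrite -(ler_pM2r zp) -expr2 -(norm_adj (elt T)) -cstar_identity adjK norm_adj.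
rewrite -[_ ** _](addKr (scal T *: adj (elt T))).
rewrite (le_trans (ler_normD _ _)) // mulrDl addrC lerD //.
  by rewrite -(norm_adj (elt T)) hT.
by rewrite normrN normrZ norm_adj.
Qed.

(** On A this is |Ta|^2 = |a* T*T a| <= c^2 |a|^2. *)
Lemma bnd_adjoint T c : 0 <= c -> bnd (ustar T * T) (c ^+ 2) -> bnd T c.
Proof.
move=> c0 [sT hT]; split=> [|a].
  rewrite -(@ler_pXn2r _ 2) ?nnegrE // (le_trans _ sT) //=.
  by rewrite normrM norm_conjC expr2.
rewrite -(@ler_pXn2r _ 2) ?nnegrE ?mulr_ge0 //.
rewrite -cstar_identity act_adjoint (le_trans (norm_cmul _ _)) //.
by rewrite norm_adj exprMn (expr2 `|a|) mulrCA ler_wpM2l.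
Qed.

(** |T*a|^2 = |a* T T* a| <= |a| c |T*a|, and |T*a| cancels. *)
Lemma bnd_star T c : bnd T c -> bnd (ustar T) c.
Proof.
move=> bT; have c0 := bnd_ge0 bT; case: bT => [sT hT]; split=> [|a].
  by rewrite norm_conjC.
have [->|z0] := eqVneq (act (ustar T) a) 0; first by rewrite normr0 mulr_ge0.
have zp : 0 < `|act (ustar T) a| by rewrite normr_gt0.
rewrite -(ler_pM2r zp) -expr2 -cstar_identity act_adjoint ustarK actM.
by rewrite (le_trans (norm_cmul _ _)) // norm_adj -mulrA mulrCA ler_wpM2l.
Qed.

End UnitizedCentre.
Arguments ucenter {R} A.

(** * Square roots in the unitized centre and norm bounds drawn from them *)

Section SquareRoot.
Context {R : realType} {A : cstarAlgType R}.
Implicit Types (T S : ucenter A) (k c : R[i]).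

Lemma archi_inv (e : R[i]) : 0 < e -> exists n : nat, n.+1%:R^-1 < e.
Proof.
case: e => e e'; rewrite ltcE /= => /andP[/eqP -> e0].
have [n _ /(_ n (leqnn n)) /= Hn] := near_infty_natSinv_lt (PosNum e0).
exists n; have -> : n.+1%:R^-1 = (n.+1%:R^-1)%:C%C :> R[i].
  by rewrite fmorphV rmorph_nat.
by rewrite ltcR.
Qed.

Lemma central_limit (l : A) :
  (forall e : R[i], 0 < e -> exists2 z, central z & `|l - z| < e) -> central l.
Proof.
move=> H b; apply/eqP; rewrite -subr_eq0 -normr_eq0; apply/eqP.
apply: normC_small => // e e0.
have b0 : 0 < 2 * (`|b| + 1) by rewrite mulr_gt0 // ltr_wpDl.
have [|z hz lz] := H (e / (2 * (`|b| + 1))); first by rewrite divr_gt0.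
have -> : l ** b - b ** l = (l - z) ** b - b ** (l - z).
  by rewrite cmulBl cmulBr hz opprB addrA addrNK.
rewrite (le_trans (ler_normB _ _)) //.
apply: (@le_trans _ _ (`|l - z| * (2 * (`|b| + 1)))); last first.
  by rewrite -ler_pdivlMr // ltW.
rewrite mulrCA mulr_natl mulr2n lerD // (le_trans (norm_cmul _ _)) //.
  by rewrite ler_wpM2l // lerDl.
by rewrite mulrC ler_wpM2l // lerDl.
Qed.

Lemma bnd_parts T : bnd T (`|scal T| + `|elt T|).
Proof.
split=> [|a]; first by rewrite lerDl.
by rewrite mulrDl (le_trans (ler_normD _ _)) // normrZ lerD2l norm_cmul.
Qed.

Lemma ideal_opp (B I : set A) x : ideal B I -> I x -> I (- x).
Proof. by move=> iI Ix; rewrite -scaleN1r; exact: (idealZ iI). Qed.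

Lemma idealB (B I : set A) x y : ideal B I -> I x -> I y -> I (x - y).
Proof. by move=> iI Ix Iy; apply: (idealD iI) => //; exact: (ideal_opp iI). Qed.

Lemma ideal_eltM (K : set A) T S : ideal setT K -> K (elt T) -> K (elt S) ->
  K (elt (T * S)).
Proof.
move=> iK KT KS; apply: (idealD iK); last exact: (ideal_mull iK).
by apply: (idealD iK); exact: (idealZ iK).
Qed.

Fixpoint major (n : nat) : R := if n is m.+1 then (1 + major m ^+ 2) / 2 else 0.

(** With u = 1 - r the recursion is u -> u - u^2/2, increasing on [0,1]; inserting u = 2/(n+2) gives
    2(n+1)/(n+2)^2 <= 2/(n+3). *)
Lemma major_bound n : 0 <= major n <= 1 /\ (1 - major n) * n.+2%:R <= 2.
Proof.
elim: n => [|n [/andP[r0 r1] IH]] /=.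
  by split; [rewrite lexx ler01|rewrite subr0 mul1r lexx].
have n0 : 0 <= n%:R :> R by rewrite ler0n.
move: (major n) r0 r1 IH => r r0 r1.
rewrite -!(natr1 n.+2) -!(natr1 n.+1) -(natr1 n).
move: n%:R n0 => m m0 IH.
split; first by apply/andP; split; nra.
nra.
Qed.

Lemma major_lim c (e : R[i]) : 0 <= c -> 0 < e ->
  exists n, c * (1 - (major n)%:C%C) < e.
Proof.
move=> c0 e0; have p0 : 0 < e / (2 * (c + 1)).
  by rewrite divr_gt0 // mulr_gt0 // ltr_wpDl.
have [n Hn] := archi_inv p0; exists n.
have [_ Mn] := major_bound n.
apply: (@le_lt_trans _ _ (2 * (c + 1) / n.+1%:R)); last first.
  by rewrite mulrC -ltr_pdivlMr // mulr_gt0 // ltr_wpDl.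
rewrite -mulrA mulrCA ler_pM // ?lerDl //.
  rewrite subr_ge0 -[1](rmorph1 (real_complex R)) lecR.
  by have [/andP[]] := major_bound n.
rewrite ler_pdivlMr // -(rmorph1 (real_complex R)) -(rmorph_nat (real_complex R) 2).
rewrite -(rmorph_nat (real_complex R) n.+1) -rmorphB -rmorphM lecR (le_trans _ Mn) //.
rewrite ler_wpM2l ?ler_nat // subr_ge0.
by have [/andP[]] := major_bound n.
Qed.

(** * The iteration for 1 - sqrt(T), with explicit error bounds *)

Section Iteration.
Variables (T : ucenter A) (s : R[i]).
Hypotheses (Tsa : ustar T = T) (T1 : bnd (1 - T) 1).
Hypotheses (Ts : scal T = s ^+ 2) (s1 : `|1 - s| <= 1).

(* The iterates increase to 1 - sqrt T; their coefficients in 1 - T are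
   nonnegative, so the scalar iteration [major] at 1 - T = 1 dominates. *)
Let half := scalar 2^-1 : ucenter A.
Fixpoint iterate n : ucenter A :=
  if n is m.+1 then half * ((1 - T) + iterate m ^+ 2) else 0.

Local Notation y := iterate.
Local Notation r := (fun n => (major n)%:C%C : R[i]).
Local Notation e := (fun n => 1 - (major n)%:C%C : R[i]).

Let rS n : r n.+1 = 2^-1 * (1 + r n ^+ 2).
Proof. by rewrite /= rmorphM fmorphV rmorphD rmorph1 rmorphXn rmorph_nat mulrC. Qed.

Let yS n : y n.+1 = half * ((1 - T) + y n ^+ 2).
Proof. by []. Qed.

Let halfb : bnd half 2^-1.
Proof. by apply: bnd_scalar; rewrite ger0_norm // invr_ge0. Qed.

Let r_ge0 n : 0 <= r n.
Proof. by rewrite -(rmorph0 (real_complex R)) lecR; case: (major_bound n) => /andP[]. Qed.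

Let r_le1 n : r n <= 1.
Proof. by rewrite -(rmorph1 (real_complex R)) lecR; case: (major_bound n) => /andP[]. Qed.

Let e_ge0 n : 0 <= e n. Proof. by rewrite subr_ge0. Qed.

Lemma iterate_bnd n : bnd (y n) (r n).
Proof.
elim: n => [|n IH]; first exact: bnd0.
by rewrite rS; apply: bndM => //; apply: bndD => //; exact: bndM.
Qed.

(** Both sequences satisfy a_(n+2) - a_(n+1) = (a_(n+1) - a_n)(a_(n+1) + a_n)/2, so the bound
    propagates factor by factor. *)
Lemma iterate_step n : bnd (y n.+1 - y n) (r n.+1 - r n).
Proof.
elim: n => [|n IH]; first by rewrite !subr0; exact: iterate_bnd 1%N.
have -> : y n.+2 - y n.+1 = half * ((y n.+1 - y n) * (y n.+1 + y n)).
  by rewrite [y n.+2]yS {2}[y n.+1]yS; ring.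
have -> : r n.+2 - r n.+1 = 2^-1 * ((r n.+1 - r n) * (r n.+1 + r n)).
  by rewrite [r n.+2]rS {2}[r n.+1]rS; ring.
by apply: bndM => //; apply: bndM => //; apply: bndD; exact: iterate_bnd.
Qed.

Lemma iterate_diff m n : (n <= m)%N -> bnd (y m - y n) (r m - r n).
Proof.
move=> /subnK <-; elim: (m - n)%N => [|k IH].
  by rewrite add0n !subrr; exact: bnd0.
rewrite addSn.
have -> : y (k + n).+1 - y n = (y (k + n).+1 - y (k + n)) + (y (k + n) - y n).
  by rewrite addrA subrK.
have -> : r (k + n).+1 - r n = (r (k + n).+1 - r (k + n)) + (r (k + n) - r n).
  by rewrite addrA subrK.
by apply: bndD => //; exact: iterate_step.
Qed.

(** Since scal T = s^2, the number 1 - s is a fixed point of the scalar recursion; its distance to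
    the iterates obeys the factored recursion that gives e_(n+1) = e_n (1 + r_n)/2. This selects the
    root s. *)
Lemma iterate_scal n : `|1 - s - scal (y n)| <= e n.
Proof.
elim: n => [|n IH]; first by rewrite /= !subr0.
have -> : 1 - s - scal (y n.+1) = 2^-1 * ((1 - s - scal (y n)) * (1 - s + scal (y n))).
  by rewrite /= -/(scal T) Ts; field.
have -> : e n.+1 = 2^-1 * (e n * (1 + r n)).
  by rewrite rS; field.
rewrite !normrM ger0_norm ?invr_ge0 // ler_wpM2l ?invr_ge0 // ler_pM //.
by rewrite (le_trans (ler_normD _ _)) // lerD //; case: (iterate_bnd n).
Qed.

Lemma e_le m n : (n <= m)%N -> e m <= e n.
Proof. by move=> /iterate_diff/bnd_ge0; rewrite lerD2l lerN2 subr_ge0. Qed.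

Lemma iterate_elt m n : (n <= m)%N -> `|elt (y m) - elt (y n)| <= 2 * e n.
Proof.
move=> nm; have /norm_elt/= /le_trans -> // := iterate_diff nm.
have -> : 2 * e n = (r m - r n) + (e m + e n) by ring.
rewrite lerD2l -[scal _ - _]addr0 -(subrr (1 - s)).
have -> : scal (y m) - scal (y n) + (1 - s - (1 - s)) =
  (1 - s - scal (y n)) - (1 - s - scal (y m)) by ring.
rewrite (addrC (e m)).
by rewrite (le_trans (ler_normB _ _)) // lerD //; exact: iterate_scal.
Qed.

Lemma iterate_star n : ustar (y n) = y n.
Proof.
elim: n => [|n IH]; first by rewrite -[y 0]/(scalar 0) ustar_scalar rmorph0.
rewrite /= ustarM ustar_scalar expr2 ustarD ustarM IH ustarD ustarN ustar1 Tsa.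
by rewrite fmorphV rmorph_nat.
Qed.

(** S is 1 minus the limit of the iterates. The clause on K holds because the A-parts of all
    iterates lie in K and K is closed; in [truncation] it places [elt p] in every ideal containing
    h. *)
Lemma usqrt_ex : exists S, [/\ ustar S = S, S * S = T, scal S = s, bnd (1 - S) 1 &
  forall K, ideal setT K -> K (elt T) -> K (elt S)].
Proof.
have [l [lb lc]] := complete_limit iterate_elt (fun e0 => @major_lim 2 e0 (ler0n _ 2)).
have cl : central l.
  apply: central_limit => d /lc[n ln]; exists (elt (y n)) => //.
  exact: elt_central.
(* The limit of the scalar parts is 1 - s by [iterate_scal]. The error 3 e_n below is e_n for the
   scalar part plus 2 e_n for the A-part. *)
pose Y := @UCenter _ _ (1 - s) l cl.
have YD n : bnd (Y - y n) (3 * e n).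
  apply: bnd_le (bnd_parts _) _; rewrite /=.
  have -> : 3 * e n = e n + 2 * e n by ring.
  by rewrite lerD //; exact: iterate_scal.
have Y1 : bnd Y 1.
  apply: bnd_lim => d d0; have [n Hn] := @major_lim 3 d (ler0n _ 3) d0.
  have -> : Y = y n + (Y - y n) by ring.
  by apply: bnd_le (bndD (iterate_bnd n) (YD n)) _; rewrite lerD // ltW.
exists (1 - Y); split.
- apply/eqP; rewrite -subr_eq0; apply/eqP; apply: bnd_eq0 => d d0.
  have [n Hn] := @major_lim 6 d (ler0n _ 6) d0.
  have -> : ustar (1 - Y) - (1 - Y) = (Y - y n) - ustar (Y - y n).
    by rewrite !ustarD !ustarN ustar1 iterate_star; ring.
  apply: bnd_le (bndB (YD n) (bnd_star (YD n))) _; apply: le_trans (ltW Hn).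
  by rewrite -mulrDl -natrD.
- apply/eqP; rewrite -subr_eq0; apply/eqP; apply: bnd_eq0 => d d0.
  have [n Hn] := @major_lim 12 d (ler0n _ 12) d0.
  (* This follows from 2 y_(n+1) = 1 - T + y_n^2. As Y and y_n have norm at most 1, the terms are
     bounded by 6 e_n, 3 e_n and 3 e_n, whence the constant 12. *)
  have E : (1 - Y) * (1 - Y) - T =
      (Y - y n) * (Y + y n) - (Y - y n.+1) - (Y - y n.+1).
    have : y n.+1 + y n.+1 = 1 - T + y n ^+ 2.
      by rewrite /= -mulrDl scalar_half mul1r.
    move=> H; have -> : T = 1 - (y n.+1 + y n.+1 - y n ^+ 2) by rewrite H; ring.
    by ring.
  rewrite E; apply: bnd_le (bndB (bndB (bndM (YD n) (bndD Y1 (iterate_bnd n)))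
    (YD n.+1)) (YD n.+1)) _.
  apply: le_trans (ltW Hn).
  have -> : 12 * e n = 3 * e n * (1 + 1) + 3 * e n + 3 * e n by ring.
  rewrite !lerD // ?ler_wpM2l ?mulr_ge0 //; try exact: e_le.
  by rewrite lerD2l.
- by rewrite /= opprB addrC subrK.
- by rewrite opprB addrC subrK.
move=> K iK KT; rewrite /= add0r; apply: (ideal_opp iK).
have Ky n : K (elt (y n)).
  elim: n => [|n IH]; first exact: ideal0 iK.
  apply: ideal_eltM => //; first exact: ideal0 iK.
  rewrite /=; apply: (idealD iK); last exact: ideal_eltM.
  by rewrite add0r; exact: (ideal_opp iK).
apply: (closed_normP K).1; first exact: ideal_closed iK.
by move=> d /lc[n ln]; exists (elt (y n)).
Qed.

End Iteration.

Lemma scalarI2 : scalar 'i * scalar 'i = -1 :> ucenter A.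
Proof. by rewrite -scalarM -expr2 sqrCi scalarN. Qed.

Lemma ustar_scalari : ustar (scalar 'i) = - scalar 'i :> ucenter A.
Proof. by rewrite ustar_scalar conjCi scalarN. Qed.

Lemma bnd_scalari : bnd (scalar 'i : ucenter A) 1.
Proof. by apply: bnd_scalar; rewrite normCi. Qed.

Lemma bnd_scalar_half : bnd (scalar 2^-1 : ucenter A) 2^-1.
Proof. by apply: bnd_scalar; rewrite ger0_norm // invr_ge0. Qed.

(* If w is the square root of 1 - T^2 then T + iw is unitary. *)
Lemma bnd_one_sub_sqr T : ustar T = T -> bnd T 1 -> bnd (1 - T * T) 1.
Proof.
move=> Tsa T1; pose t := scal T.
have tE : t ^+ 2 = `|t| ^+ 2 by rewrite normCK -[t^*]/(scal (ustar T)) Tsa.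
have t2 : 0 <= t ^+ 2 <= 1.
  by rewrite tE exprn_ge0 //= expr_le1 //; case: T1.
case/andP: t2 => t0 t1.
have s0 : 0 <= sqrtC (1 - t ^+ 2) by rewrite sqrtC_ge0 subr_ge0.
have s1 : sqrtC (1 - t ^+ 2) <= 1.
  by rewrite -(@expr_le1 _ 2) // sqrtCK gerBl.
have [| | | |w [wsa wE _ _ _]] := @usqrt_ex (1 - T * T) (sqrtC (1 - t ^+ 2)).
- by rewrite ustarD ustarN ustar1 ustarM Tsa.
- by rewrite opprB addrC subrK -[1]mulr1; exact: bndM.
- by rewrite sqrtCK /= expr2.
- by rewrite ger0_norm ?subr_ge0 // gerBl.
have I2 := scalarI2; set I := scalar 'i in I2.
have cE : ustar (T + I * w) = T - I * w.
  by rewrite ustarD ustarM ustar_scalari Tsa wsa mulNr.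
have ccE : (T - I * w) * (T + I * w) = 1.
  have -> : (T - I * w) * (T + I * w) = T * T - I * I * (w * w) by ring.
  by rewrite I2 wE; ring.
have bc : bnd (T + I * w) 1.
  by apply: bnd_adjoint => //; rewrite cE ccE expr1n; exact: bnd1.
have bc' : bnd (T - I * w) 1 by rewrite -cE; exact: bnd_star.
(* For the unitary c = T + iw one has w = (i/2)(c* - c), so |w| <= 1; and 1 - T^2 = w^2. *)
have wb : bnd w 1.
  have -> : w = I * (scalar 2^-1 * ((T - I * w) - (T + I * w))).
    have -> : I * (scalar 2^-1 * ((T - I * w) - (T + I * w))) =
      - (I * I) * (scalar 2^-1 + scalar 2^-1) * w by ring.
    by rewrite I2 scalar_half; ring.
  apply: bnd_le (bndM bnd_scalari (bndM bnd_scalar_half (bndB bc' bc))) _.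
  by rewrite mul1r mulVf.
by rewrite -wE -[1]mulr1; exact: bndM.
Qed.

Lemma ustar_of_central (z : A) (hz : central z) :
  ustar (of_central hz) = of_central (central_adj hz).
Proof. by apply: ucenter_eq; rewrite //= rmorph0. Qed.

(** The elements a = Z + Z* and b = i(Z* - Z) are self-adjoint of norm at most 1, and a^2 + b^2 = 4
    Z*Z. So 1 - Z*Z = 1/2 + ((1 - a^2) + (1 - b^2))/4, bounded by 1/2 + 2/4. *)
Lemma bnd_one_sub_adjM (z : A) (hz : central z) : `|z| <= 2^-1 ->
  bnd (1 - ustar (of_central hz) * of_central hz) 1.
Proof.
move=> z1; set Z := of_central hz; set Z' := ustar Z.
have bZ : bnd Z 2^-1 by exact: bnd_of_central.
have bZ' : bnd Z' 2^-1 by exact: bnd_star.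
have I2 := scalarI2; set I := scalar 'i in I2.
have a1 : bnd (1 - (Z + Z') * (Z + Z')) 1.
  apply: bnd_one_sub_sqr; first by rewrite ustarD ustarK addrC.
  by apply: bnd_le (bndD bZ bZ') _; rewrite -[2^-1]mul1r -splitr.
have b1 : bnd (1 - (I * (Z' - Z)) * (I * (Z' - Z))) 1.
  apply: bnd_one_sub_sqr.
    by rewrite ustarM ustar_scalari ustarD ustarN ustarK -/Z' -/I; ring.
  apply: bnd_le (bndM bnd_scalari (bndB bZ' bZ)) _.
  by rewrite mul1r -[2^-1]mul1r -splitr.
set h := scalar 2^-1 : ucenter A.
have -> : 1 - Z' * Z = h + h * (h * ((1 - (Z + Z') * (Z + Z')) +
      (1 - (I * (Z' - Z)) * (I * (Z' - Z))))).
  have -> : I * (Z' - Z) * (I * (Z' - Z)) = (I * I) * ((Z' - Z) * (Z' - Z)) by ring.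
  apply/eqP; rewrite I2 -subr_eq0; apply/eqP.
  have -> : 1 - Z' * Z - (h + h * (h * (1 - (Z + Z') * (Z + Z') +
     (1 - -1 * ((Z' - Z) * (Z' - Z)))))) =
     (h + h - 1) * ((h + h + 1) * (Z * Z') - (h + 1)) by ring.
  by rewrite scalar_half subrr mul0r.
apply: bnd_le (bndD bnd_scalar_half (bndM bnd_scalar_half
  (bndM bnd_scalar_half (bndD a1 b1)))) _.
by rewrite -[1 + 1]/(2%:R) mulVf // mulr1 -[2^-1]mul1r -splitr.
Qed.

End SquareRoot.

(** * Truncations of central elements, primeness and localization *)

Section CentralCalculus.
Context {R : realType} {A : cstarAlgType R}.
Implicit Types (x y z e s : A) (M Q K : set A) (T S : ucenter A) (k d : R[i]).

Lemma half_le1 : 2^-1 <= 1 :> R[i].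
Proof. by rewrite invf_le1 ?ler1n ?ltr0n. Qed.

Lemma small_multiple z : exists2 k, k != 0 & `|k *: z| <= 2^-1.
Proof.
have p : 0 < 2 * (`|z| + 1) by rewrite mulr_gt0 // ltr_wpDl.
exists (2 * (`|z| + 1))^-1; first by rewrite invr_neq0 // gt_eqF.
rewrite normrZ ger0_norm ?invr_ge0 ?(ltW p) // mulrC ler_pdivrMr //.
by rewrite mulrA mulVf // mul1r lerDl.
Qed.

Lemma ideal_unscale (B I : set A) k x : ideal B I -> k != 0 -> I (k *: x) -> I x.
Proof.
by move=> iI k0 Ix; rewrite -(scale1r x) -(mulVf k0) -scalerA; exact: (idealZ iI).
Qed.

Lemma eltM0 T S : scal T = 0 -> scal S = 0 -> elt (T * S) = elt T ** elt S.
Proof. by move=> T0 S0; rewrite /= T0 S0 !scale0r !add0r. Qed.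

Lemma ideal_eltMr K T S : ideal setT K -> scal S = 0 -> K (elt S) -> K (elt (T * S)).
Proof.
move=> iK S0 KS; rewrite /= S0 scale0r addr0.
by apply: (idealD iK); [exact: (idealZ iK)|exact: (ideal_mull iK)].
Qed.

Lemma norm_elt0 T c : scal T = 0 -> bnd T c -> `|elt T| <= c.
Proof. by move=> T0 /norm_elt; rewrite T0 normr0 addr0. Qed.

Lemma norm_elt_adjoint T c : scal T = 0 -> bnd (ustar T * T) c -> `|elt T| ^+ 2 <= c.
Proof.
move=> T0 b; rewrite -cstar_identity -[adj (elt T)]/(elt (ustar T)) -eltM0 //.
  by apply: norm_elt0 b; rewrite /= T0 mulr0.
by rewrite /= T0 rmorph0.
Qed.

(* With T = 1 - z*z, the Cesaro means C_n of the powers of T satisfy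
   |z C_n|^2 = |(1 - T^n) C_n| / n, and z - z C_n lies in the ideal. *)
Lemma ideal_adjM Q z : ideal setT Q -> central z -> Q (adj z ** z) -> Q z.
Proof.
move=> iQ; have [k k0] := small_multiple z.
move=> zs hz Qz; apply: (ideal_unscale iQ k0).
have {Qz} : Q (adj (k *: z) ** (k *: z)).
  by rewrite adjZ cmulZl cmulZr; do 2 apply: (idealZ iQ).
move: (centralZ k hz) zs; move: {k k0 z hz} (k *: z) => z hz z1 Qz.
pose Z := of_central hz; pose T := 1 - ustar Z * Z.
have TE : 1 - T = ustar Z * Z by rewrite opprB addrC subrK.
have T1 : bnd T 1 by exact: bnd_one_sub_adjM.
have Tsa : ustar T = T.
  by rewrite ustarD ustarN ustar1 ustarM ustarK mulrC.
have Tn n : bnd (T ^+ n) 1.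
  elim: n => [|n IH]; first by rewrite expr0; exact: bnd1.
  by rewrite exprS -[1]mulr1; exact: bndM.
(* [D n] is n times the Cesaro mean C_n. *)
pose D n := \sum_(i < n) T ^+ i.
have DT n : (1 - T) * D n = 1 - T ^+ n.
  by rewrite -[1 - T]opprB mulNr -subrX1 opprB.
have DS n : D n.+1 = D n + T ^+ n by rewrite /D big_ord_recr.
have Dsa n : ustar (D n) = D n.
  elim: n => [|n IH]; first by rewrite /D big_ord0 -[0]/(scalar 0) ustar_scalar rmorph0.
  rewrite DS ustarD IH; congr (_ + _).
  elim: n {IH} => [|n IH]; first by rewrite expr0 ustar1.
  by rewrite exprS ustarM IH Tsa.
have Dn n : bnd (D n) n%:R.
  elim: n => [|n IH]; first by rewrite /D big_ord0; exact: bnd0.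
  by rewrite DS -natr1; exact: bndD.
(* Each 1 - T^i is a multiple of 1 - T = Z*Z, hence so is n - D_n; this puts z - z C_n in Q. *)
have DE n : exists E, n%:R - D n = E * (1 - T).
  elim: n => [|n [E IH]]; first by exists 0; rewrite /D big_ord0 subrr mul0r.
  exists (E + D n); rewrite mulrDl -IH (mulrC (D n)) DT DS -natr1.
  by ring.
have DZ n : `|elt (D n * Z)| ^+ 2 <= n%:R * 2.
  apply: norm_elt_adjoint; first by rewrite /= mulr0.
  have -> : ustar (D n * Z) * (D n * Z) = D n * ((1 - T) * D n).
    by rewrite ustarM Dsa TE; ring.
  by rewrite DT; apply: bndM => //; apply: bndB => //; exact: bnd1.
apply: (closed_normP Q).1; first exact: ideal_closed iQ.
(* With N = [n.+1], the squared error |z C_N|^2 is at most 2N/N^2, so 1/N < e^2/2 suffices. *)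
move=> e e0; have [n Hn] := archi_inv (divr_gt0 (exprn_gt0 2 e0) (ltr0Sn _ 1)).
have [E HE] := DE n.+1.
have n0 : n.+1%:R != 0 :> R[i] by rewrite pnatr_eq0.
have np : 0 < n.+1%:R :> R[i] by rewrite ltr0n.
exists (n.+1%:R^-1 *: elt ((n.+1%:R - D n.+1) * Z)).
  apply: (idealZ iQ); rewrite HE TE.
  have -> : E * (ustar Z * Z) * Z = (Z * E) * (ustar Z * Z) by ring.
  refine (@ideal_eltMr Q (Z * E) (ustar Z * Z) iQ _ _); first by rewrite /= mulr0.
  by rewrite eltM0 //= rmorph0.
have scn m : scal (m%:R : ucenter A) = m%:R.
  by elim: m => [|m IH] //; rewrite -!natr1 scalD IH.
have en m : elt (m%:R : ucenter A) = 0.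
  by elim: m => [|m IH] //; rewrite -natr1 /= IH addr0.
have -> : elt ((n.+1%:R - D n.+1) * Z) = n.+1%:R *: z - elt (D n.+1 * Z).
  rewrite mulrBl [LHS]/= -[scal n.+1%:R]/(scal (n.+1%:R : ucenter A)) scn en.
  by rewrite scale0r cmul0x !addr0.
rewrite scalerBr scalerA mulVf // scale1r opprB addrC subrK normrZ.
rewrite -(@ltr_pXn2r _ 2) ?nnegrE ?mulr_ge0 ?(ltW e0) //.
rewrite exprMn ger0_norm ?invr_ge0 // (@le_lt_trans _ _ (n.+1%:R^-1 ^+ 2 * (n.+1%:R * 2))) //.
  by rewrite ler_pM2l // exprn_gt0 // invr_gt0.
by rewrite expr2 mulrA mulfVK // -ltr_pdivlMr.
Qed.

(* p is (d^2 - h^2)_+ and v is (h^2 - d^2)_+. *)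
Lemma truncation (h : A) (hh : central h) d : adj h = h -> `|h| <= 2^-1 ->
  0 < d -> d <= 2^-1 -> exists p v : ucenter A,
  [/\ scal p = d ^+ 2, scal v = 0, v * p = 0,
      bnd (of_central hh * of_central hh * (of_central hh * of_central hh) -
           of_central hh * of_central hh * v) (d + d) &
      forall K, ideal setT K -> K h -> K (elt p)].
Proof.
move=> hsa h1 d0 d1; pose H := of_central hh.
have Hsa : ustar H = H by rewrite ustar_of_central; apply: ucenter_eq.
have d1' : d <= 1 by rewrite (le_trans d1) // half_le1.
have dge0 := ltW d0.
have dsa : Num.conj d = d by apply/CrealP; rewrite ger0_real.
have H1 : bnd H 2^-1 by exact: bnd_of_central.
have q4 : 2^-1 * 2^-1 + 2^-1 <= 1 :> R[i].
  rewrite -[leRHS](@mulVf _ 2%:R) // mulr_natr mulr2n lerD2r.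
  by rewrite ler_piMr ?invr_ge0 ?half_le1.
have d2 : d ^+ 2 <= 2^-1.
  by rewrite expr2 (le_trans _ d1) // ler_piMr.
have d2b : bnd (scalar (d ^+ 2) : ucenter A) (d ^+ 2).
  by apply: bnd_scalar; rewrite ger0_norm // exprn_ge0.
pose x := H * H - scalar (d ^+ 2).
have xsa : ustar x = x.
  by rewrite ustarD ustarN ustarM Hsa ustar_scalar rmorphXn /= dsa.
have x1 : bnd x 1.
  apply: bnd_le (bndB (bndM H1 H1) d2b) _.
  by apply: le_trans q4; rewrite lerD2l.
have scx : scal x = - d ^+ 2 by rewrite /= mulr0 add0r.
have le1 c : 0 <= c -> c <= 1 -> `|1 - c| <= 1 :> R[i].
  by move=> c0 c1; rewrite ger0_norm ?subr_ge0 // gerBl.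
(* m is |x| for x = h^2 - d^2, and [n] below is the square root of m. Then p = (m - x)/2 and v = (m
   + x)/2 are the negative and positive parts of x, and vp = (m^2 - x^2)/4 = 0. *)
have [| | | |m [msa mE scm m1 mK]] := @usqrt_ex _ _ (x * x) (d ^+ 2).
- by rewrite ustarM xsa.
- exact: bnd_one_sub_sqr.
- by rewrite scalM scx mulrNN -expr2.
- by rewrite le1 ?exprn_ge0 // expr_le1.
have [n [nsa nE _ _ _]] := usqrt_ex msa m1 scm (le1 _ dge0 d1').
pose hf := scalar 2^-1 : ucenter A.
have hfE : hf + hf = 1 by exact: scalar_half.
have hfsa : ustar hf = hf by rewrite ustar_scalar fmorphV rmorph_nat.
pose p := hf * (m - x); pose v := p + x.
have psa : ustar p = p by rewrite ustarM hfsa ustarD ustarN msa xsa.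
have vp : v * p = 0.
  have -> : v * p = hf * hf * (m * m - x * x) + (1 - (hf + hf)) * (x * (hf * (m - x))).
    by rewrite /v /p; ring.
  by rewrite hfE mE !subrr mulr0 mul0r addr0.
have vE : m + x = v + v.
  rewrite /v /p; have -> : hf * (m - x) + x + (hf * (m - x) + x) =
     (hf + hf) * (m - x) + x + x by ring.
  by rewrite hfE; ring.
have scp : scal p = d ^+ 2.
  by rewrite scalM scalD scalN scm scx opprK -mulr2n -mulr_natl mulrA mulVf ?mul1r.
have mb : bnd m 2.
  have -> : m = 1 - (1 - m) by rewrite opprB addrC subrK.
  by apply: bndB => //; exact: bnd1.
have Hpb : bnd (H * p) 1.
  apply: bnd_le (bndM H1 (bndM bnd_scalar_half (bndB mb x1))) _.
  rewrite mulrA -invfM -natrM -[2 + 1]/(2%:R + 1%:R) -natrD mulrC ler_pdivrMr // mul1r.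
  by rewrite ler_nat.
have I2 : scalar 'i * scalar 'i = -1 :> ucenter A by exact: scalarI2.
set I := scalar 'i : ucenter A in I2.
(* Here c*c = h^2 p^2 (m + h^2) = h^2 p^2 (2v + d^2) = d^2 (hp)^2, because m + x = 2v and vp = 0.
   Hence |c| <= d, and its imaginary part h^2 p obeys the same bound. *)
pose c := H * p * n + I * (H * H * p).
have cE : ustar c = H * p * n - I * (H * H * p).
  rewrite ustarD (ustarM _ n) (ustarM H p) (ustarM I) (ustarM (H * H)) (ustarM H H).
    by rewrite psa nsa Hsa ustar_scalari mulNr.
have ccE : ustar c * c = scalar (d ^+ 2) * (H * p * (H * p)).
  rewrite cE /c.
  have -> : (H * p * n - I * (H * H * p)) * (H * p * n + I * (H * H * p)) =
    H * H * p * p * (n * n - (I * I) * (x + scalar (d ^+ 2))) by rewrite /x; ring.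
  rewrite I2 nE mulN1r opprK addrA vE.
  have -> : H * H * p * p * (v + v + scalar (d ^+ 2)) =
    H * H * p * (v * p) + H * H * p * (v * p) + scalar (d ^+ 2) * (H * p * (H * p)) by ring.
  by rewrite vp mulr0 !add0r.
have cb : bnd c d.
  apply: bnd_adjoint => //; rewrite ccE; apply: bnd_le (bndM d2b (bndM Hpb Hpb)) _.
  by rewrite !mulr1.
have cb' := bnd_star cb.
have HHp : bnd (H * H * p) d.
  have -> : H * H * p = hf * (I * (ustar c - c)).
    have -> : hf * (I * (ustar c - c)) = - (I * I) * (hf + hf) * (H * H * p).
      by rewrite cE /c; ring.
    by rewrite I2 hfE; ring.
  apply: bnd_le (bndM bnd_scalar_half (bndM bnd_scalari (bndB cb' cb))) _.
  by rewrite mul1r mulrDr -mulrDl -[2^-1]mul1r -splitr mul1r.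
exists p, v; split => //.
- by rewrite scalD scp scx subrr.
- rewrite -/H; have -> : H * H * (H * H) - H * H * v =
    scalar (d ^+ 2) * (H * H) - H * H * p by rewrite /v /x; ring.
  apply: bnd_le (bndB (bndM d2b (bndM H1 H1)) HHp) _.
  rewrite lerD2r expr2 -mulrA ler_piMr // mulr_ile1 ?mulr_ge0 ?invr_ge0 //.
  by rewrite mulr_ile1 ?invr_ge0 ?half_le1.
move=> K iK Kh.
have Kx : K (elt x).
  have -> : elt x = elt (H * H) by rewrite [LHS]/= subr0.
  exact: (@ideal_eltM _ _ K H H iK).
have Km : K (elt m) by apply: mK => //; exact: (@ideal_eltM _ _ K x x iK).
have -> : elt p = 2^-1 *: (elt m - elt x).
  by rewrite [LHS]/= scaler0 cmul0x !addr0.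
by apply: (idealZ iK); exact: (idealB iK).
Qed.

(** Primeness against central factors: it makes the central elements outside M closed under
    products, as localization at M requires. *)
Definition central_prime M := forall x y, central x -> M (x ** y) -> M x \/ M y.

Lemma central_adjM z : central z -> central (adj z ** z).
Proof. by move=> hz; apply: centralM => //; exact: central_adj. Qed.

Lemma norm_adjM_le z : `|z| <= 2^-1 -> `|adj z ** z| <= 2^-1.
Proof.
move=> z1; rewrite cstar_identity expr2 (le_trans _ z1) // ler_piMr //.
by rewrite (le_trans z1) // half_le1.
Qed.

(* With h = z*z, Q is prime and h^4 is the limit of the h^2 v. *)
Lemma mem_truncation Q z : ideal setT Q -> central_prime Q -> central z ->
  `|z| <= 2^-1 ->
  (forall (p v : ucenter A) d, 0 < d -> scal p = d ^+ 2 -> scal v = 0 -> v * p = 0 ->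
    (forall K, ideal setT K -> K z -> K (elt p)) -> Q (elt v)) ->
  Q z.
Proof.
move=> iQ pQ hz z1 HQ; apply: ideal_adjM => //.
have hh := central_adjM hz; set h := adj z ** z in hh *.
have hsa : adj h = h by rewrite /h adjM adjK.
suff : Q (h ** h ** (h ** h)).
  by move=> /pQ[|/pQ[]|/pQ[]] //; exact: centralM.
have E : h ** h ** (h ** h) = elt (of_central hh * of_central hh * (of_central hh * of_central hh)).
  by rewrite !eltM0 //= ?mulr0.
apply: (closed_normP Q).1; first exact: ideal_closed iQ.
(* This d satisfies both d <= 1/2, as [truncation] requires, and 2d < e. *)
move=> e e0; pose d := e / (4 * (e + 1)).
have e1 : 0 < e + 1 by rewrite ltr_wpDl // ltW.
have d0 : 0 < d by rewrite divr_gt0 // mulr_gt0.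
have d1 : d <= 2^-1.
  rewrite ler_pdivrMr ?mulr_gt0 // mulrA.
  have -> : 2^-1 * 4 = 2 :> R[i] by field.
  by rewrite mulr_natl mulr2n -addrA lerDl addr_ge0 ?ltW.
have de : d + d < e.
  rewrite -mulr2n -mulr_natl mulrCA gtr_pMr // ltr_pdivrMr ?mulr_gt0 //.
  rewrite mul1r mulrDr mulr1 (@lt_le_trans _ _ 4) ?ltr_nat // lerDr.
  by rewrite mulr_ge0 // ltW.
have [p [v [scp scv vp b pK]]] := truncation hh hsa (norm_adjM_le z1) d0 d1.
exists (elt (of_central hh * of_central hh * v)).
  apply: ideal_eltMr => //; apply: (HQ _ _ _ d0 scp scv vp) => K iK Kz.
  by apply: pK => //; exact: (ideal_mull iK).
rewrite E (le_lt_trans _ de) //.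
by apply: norm_elt0 b; rewrite /= scv !mulr0 subr0.
Qed.

(** For z in M and e central outside M, the element s = ep is d^2 e modulo M, hence outside M, and
    sv = 0. So every truncation v lies in Q, and [mem_truncation] gives z in Q. *)
Lemma local_ideal_sub M Q : ideal setT M -> ideal setT Q -> central_prime Q ->
  ~ center setT `<=` M ->
  (forall z s, central z -> central s -> ~ M s -> s ** z = 0 -> Q z) ->
  M `&` center setT `<=` Q.
Proof.
move=> iM iQ pQ /nonsubset[e [/centerT he Me]] HQ z [Mz /centerT hz].
have [k k0 z1] := small_multiple z; apply: (ideal_unscale iQ k0).
apply: mem_truncation => //; first exact: centralZ.
move=> p v d d0 scp scv vp pK.
have Mp : M (elt p) by apply: pK => //; exact: (idealZ iM).
apply: (HQ _ (elt (of_central he * p))); try exact: elt_central.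
  rewrite /= scale0r add0r scp => Ms; apply: Me.
  have d2 : d ^+ 2 != 0 by rewrite expf_neq0 // gt_eqF.
  apply: (ideal_unscale iM d2); rewrite -[_ *: e](addrK (e ** elt p)).
  by apply: (idealB iM) => //; exact: (ideal_mull iM).
rewrite -eltM0 //; last by rewrite /= mul0r.
by rewrite -mulrA (mulrC p) vp mulr0.
Qed.

(** For a small multiple of a central z outside M, some truncation v stays outside M by
    [mem_truncation]. Take s = v and e = 1 - p/d^2, whose scalar part vanishes; pv = 0 gives es =
    s. *)
Lemma local_unit M : ideal setT M -> central_prime M -> ~ center setT `<=` M ->
  exists e s, [/\ central e, central s, ~ M s & e ** s = s].
Proof.
move=> iM pM /nonsubset[z [/centerT hz Mz]]; apply: contrapT => noes; apply: Mz.
have [k k0 z1] := small_multiple z; apply: (ideal_unscale iM k0).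
apply: mem_truncation => //; first exact: centralZ.
move=> p v d d0 scp scv vp _; apply: contrapT => Mv; apply: noes.
have d2 : d ^+ 2 != 0 by rewrite expf_neq0 // gt_eqF.
exists (elt (1 - scalar (d ^- 2) * p)), (elt v).
split => //; try exact: elt_central.
rewrite -eltM0 //; last by rewrite /= scp mulVf ?subrr.
by rewrite mulrBl mul1r -mulrA (mulrC p) vp mulr0 subr0.
Qed.

End CentralCalculus.

(** * Maximal modular ideals of A and of its ideals *)

Section MaximalIdeals.
Context {R : realType} {A : cstarAlgType R}.
Implicit Types (x y z a b e s : A) (L M N I J B : set A) (k d : R[i]).

(** Two-sided ideals without closedness, as produced by chains, sums and localization. *)
Record alg_ideal L : Prop := AlgIdeal {
  alg0 : L 0;
  algD : forall x y, L x -> L y -> L (x + y);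
  algZ : forall k x, L x -> L (k *: x);
  alg_mull : forall b x, L x -> L (b ** x);
  alg_mulr : forall x b, L x -> L (x ** b) }.

Lemma ideal_alg I : ideal setT I -> alg_ideal I.
Proof.
move=> iI; split; [exact: (ideal0 iI)|exact: (idealD iI)|exact: (idealZ iI)| |].
  by move=> b x; exact: (ideal_mull iI).
by move=> x b Ix; exact: (ideal_mulr iI).
Qed.

Lemma alg_ideal_closed I : alg_ideal I -> closed I -> ideal setT I.
Proof.
move=> aI cI; split=> //; [exact: (alg0 aI)|exact: (algD aI)|exact: (algZ aI)| |].
  by move=> b x _; exact: (alg_mull aI).
by move=> x b Ix _; exact: (alg_mulr aI).
Qed.

Lemma algB L x y : alg_ideal L -> L x -> L y -> L (x - y).
Proof.
by move=> aL Lx Ly; apply: (algD aL) => //; rewrite -scaleN1r; exact: (algZ aL).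
Qed.

Lemma coset_eq B I a b : ideal B I -> coset I a = coset I b <-> I (a - b).
Proof.
move=> iI; split=> [E|Iab].
  have : coset I b a by rewrite -E; exists 0; rewrite ?addr0 //; exact: (ideal0 iI).
  by case=> x Ix <-; rewrite addrC addKr.
apply/seteqP; split=> _ [x Ix <-].
  exists (a - b + x); first exact: (idealD iI).
  by rewrite addrA [b + _]addrC subrK.
exists (x - (a - b)); first exact: (idealB iI).
by rewrite opprB [x + _]addrC addrA [a + _]addrC subrK.
Qed.

Definition unit_mod B e I := forall b, B b -> I (e ** b - b) /\ I (b ** e - b).

Lemma quotient_unitalP B I : ideal B I ->
  quotient_unital B I <-> exists2 e, B e & unit_mod B e I.
Proof.
move=> iI; split=> -[e Be He]; exists e => // b /He[h1 h2].
  by split; apply/(coset_eq _ _ iI).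
by split; apply/(coset_eq _ _ iI).
Qed.

Lemma unit_mod_mem B I e b : ideal B I -> unit_mod B e I -> B b ->
  I (e ** b) -> I b.
Proof.
move=> iI ue Bb Ieb; rewrite -[b](subKr (e ** b)); apply: (idealB iI) => //.
by case: (ue b Bb).
Qed.

Lemma unit_mod_full B I e : ideal B I -> unit_mod B e I -> B e -> I e -> I = B.
Proof.
move=> iI ue Be Ie; apply/seteqP; split; first exact: (ideal_sub iI).
by move=> b Bb; apply: (unit_mod_mem iI ue) => //; exact: (ideal_mulr iI).
Qed.

(* Neumann series: s = sum_(n > 0) (e - x)^n gives e - x = s - (e - x) s in L. *)
Lemma unit_mod_far L e x : alg_ideal L -> unit_mod setT e L -> L x ->
  `|e - x| <= 2^-1 -> L e.
Proof.
move=> aL ue Lx dle; set d := e - x in dle.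
pose u := fix u n : A := if n is m.+1 then d + d ** u m else 0.
have uS n : u n.+1 = d + d ** u n by [].
have step n : `|u n.+1 - u n| <= 2^-1 ^+ n.+1.
  elim: n => [|n IH]; first by rewrite /= cmulx0 addr0 subr0 expr1.
  have -> : u n.+2 - u n.+1 = d ** (u n.+1 - u n).
    by rewrite cmulBr -[RHS](addrKA d) [d ** _ + d]addrC.
  by rewrite (le_trans (norm_cmul _ _)) // exprS ler_pM.
have halfE n : 2^-1 ^+ n.+1 + 2^-1 ^+ n.+1 = 2^-1 ^+ n :> R[i].
  by rewrite exprS -mulrDl -[2^-1]mul1r -splitr mul1r.
have diff m n : (n <= m)%N -> `|u m - u n| <= 2^-1 ^+ n.
  (* The subtracted power makes the induction on j close. *)
  suff H (j : nat) : `|u (j + n)%N - u n| <= 2^-1 ^+ n - 2^-1 ^+ (j + n).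
    move=> /subnK <-; apply: le_trans (H _) _.
    by rewrite gerBl exprn_ge0 // invr_ge0.
  elim: j => [|j IH]; first by rewrite !subrr normr0.
  rewrite addSn -[u _.+1](subrK (u (j + n)%N)) -addrA.
  apply: le_trans (ler_normD _ _) _; apply: le_trans (lerD (step _) IH) _.
  by rewrite -(halfE (j + n)%N) opprD addrCA [_ + (- _ - _)]addrA subrr sub0r.
have small (e0 : R[i]) : 0 < e0 -> exists n, 2^-1 ^+ n < e0.
  move=> /archi_inv[n Hn]; exists n; apply: le_lt_trans Hn.
  rewrite exprVn lef_pV2 ?posrE ?exprn_gt0 ?ltr0n //.
  by rewrite -natrX ler_nat ltn_expl.
have [l [ln _]] := complete_limit diff small.
have lE : l = d + d ** l.
  apply/eqP; rewrite -subr_eq0 -normr_eq0; apply/eqP.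
  apply: normC_small => // e0 /small[n Hn].
  have -> : l - (d + d ** l) = (l - u n.+1) - d ** (l - u n).
    rewrite cmulBr -[RHS]addrA -[X in _ = _ + X]opprD; congr (_ - _).
    by rewrite uS -[RHS]addrA [X in _ = _ + X]addrC subrK.
  apply: le_trans (ler_normB _ _) _; apply: le_trans (ltW Hn).
  rewrite -halfE lerD // (le_trans (norm_cmul _ _)) // exprS ler_pM //.
have ed : e - d = x by rewrite subKr.
have Ld : L d.
  (* The first bracket is xl with x in L, and the second lies in L because e is a unit modulo L. *)
  have -> : d = (e ** l - d ** l) - (e ** l - l).
    by rewrite opprB addrC addrA subrK {1}lE addrK.
  apply: (algB aL); last by case: (ue l Logic.I).
  by rewrite -cmulBl ed; exact: (alg_mulr aL).
by rewrite -(subrK d e) ed; exact: (algD aL).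
Qed.

Lemma MaxT_ideal M : Max setT M -> ideal setT M. Proof. by case=> [[]]. Qed.

Lemma MaxT_unit M : Max setT M -> exists2 e, unit_mod setT e M & ~ M e.
Proof.
case=> [[iM /(quotient_unitalP iM)[e _ ue]] [_ MT _]]; exists e => // Me.
by apply: MT; exact: (unit_mod_full iM ue).
Qed.

Lemma MaxT_maximal M J : Max setT M -> ideal setT J -> M `<=` J ->
  J = M \/ J = setT.
Proof.
case=> _ [_ _ H] iJ MJ; have [|JT] := EM (J = setT); first by right.
by left; exact: H.
Qed.

(** Zorn's lemma gives an algebraic ideal M above L maximal among those avoiding e. By
    [unit_mod_far] M keeps distance 1/2 from e, so its closure avoids e too and equals M. Proper
    ideals above M avoid e, a unit modulo each of them. *)
Lemma exists_Max L e : alg_ideal L -> unit_mod setT e L -> ~ L e ->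
  exists M, [/\ Max setT M, L `<=` M & ~ M e].
Proof.
move=> aL ue Le.
(* Joining L to X lets the predicate hold for the union of the empty chain as well. *)
pose P X := alg_ideal (X `|` L) /\ ~ (X `|` L) e.
have [|X [[aX Xe] Xmax]] := @Zorn_bigcup _ P.
  move=> F FP Ftot; set U := \bigcup_(X in F) X.
  have sub X : F X -> X `|` L `<=` U `|` L.
    by move=> FX x [Xx|Lx]; [left; exists X|right].
  have pick x : (U `|` L) x -> L x \/ exists2 X, F X & X x.
    by case=> [[X FX Xx]|Lx]; [right; exists X|left].
  split; last first.
    by move=> /pick[//|[X FX Xe]]; have [_] := FP X FX; apply; left.
  split.
  - by right; exact: (alg0 aL).
  - move=> x y /pick[Lx|[X FX Xx]] /pick[Ly|[Y FY Yy]].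
    + by right; exact: (algD aL).
    + by apply: (sub Y FY); have [aY _] := FP Y FY; apply: (algD aY); [right|left].
    + by apply: (sub X FX); have [aX _] := FP X FX; apply: (algD aX); [left|right].
    + have [XY|YX] := Ftot X Y FX FY.
        by apply: (sub Y FY); have [aY _] := FP Y FY; apply: (algD aY); left => //; exact: XY.
      by apply: (sub X FX); have [aX _] := FP X FX; apply: (algD aX); left => //; exact: YX.
  - move=> k x /pick[Lx|[X FX Xx]]; first by right; exact: (algZ aL).
    by apply: (sub X FX); have [aX _] := FP X FX; apply: (algZ aX); left.
  - move=> b x /pick[Lx|[X FX Xx]]; first by right; exact: (alg_mull aL).
    by apply: (sub X FX); have [aX _] := FP X FX; apply: (alg_mull aX); left.
  - move=> x b /pick[Lx|[X FX Xx]]; first by right; exact: (alg_mulr aL).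
    by apply: (sub X FX); have [aX _] := FP X FX; apply: (alg_mulr aX); left.
set M := X `|` L in aX Xe.
have LM : L `<=` M by move=> x; right.
have Mmax N : alg_ideal N -> M `<=` N -> ~ N e -> N = M.
  move=> aN MN Ne; apply/seteqP; split => //; apply: contrapT => NM.
  apply: (Xmax N).
    split; first by move=> x Xx; apply: MN; left.
    by move=> NX; apply: NM => x /NX; left.
  have -> : P N = (alg_ideal N /\ ~ N e) by rewrite /P setUidl //; exact: subset_trans MN.
  by split.
have ueM : unit_mod setT e M by move=> b _; have [h1 h2] := ue b Logic.I; split; exact: LM.
pose cl := [set x | forall d, 0 < d -> exists2 y, M y & `|x - y| < d].
have Mcl : M `<=` cl by move=> x Mx d d0; exists x => //; rewrite subrr normr0.
have mulcl (f : A -> A) (c : R[i]) : 0 <= c -> (forall x y, f x - f y = f (x - y)) ->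
    (forall x, `|f x| <= c * `|x|) -> (forall x, M x -> M (f x)) ->
    forall x, cl x -> cl (f x).
  move=> c0 fB fc fM x clx d d0; have c1 : 0 < c + 1 by rewrite ltr_wpDl.
  have [y My xy] := clx (d / (c + 1)) (divr_gt0 d0 c1); exists (f y); first exact: fM.
  rewrite fB (le_lt_trans (fc _)) // (@le_lt_trans _ _ ((c + 1) * `|x - y|)) //.
    by rewrite ler_wpM2r // lerDl.
  by rewrite mulrC -ltr_pdivlMr.
have acl : alg_ideal cl.
  split.
  - by apply: Mcl; exact: (alg0 aX).
  - move=> x y clx cly d d0; have d20 : 0 < d / 2 by rewrite divr_gt0.
    have [x' Mx' xx'] := clx _ d20; have [y' My' yy'] := cly _ d20.
    exists (x' + y'); first exact: (algD aX).
    by rewrite opprD addrACA (le_lt_trans (ler_normD _ _)) // [d]splitr ltrD.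
  - move=> k; apply: (mulcl ( *:%R k) `|k|) => // [x y|x|x Mx].
    + by rewrite scalerBr.
    + by rewrite normrZ.
    + exact: (algZ aX).
  - move=> b; apply: (mulcl (cmul b) `|b|) => // [x y|x|x Mx].
    + by rewrite cmulBr.
    + exact: norm_cmul.
    + exact: (alg_mull aX).
  - move=> x b; apply: (mulcl (cmul^~ b) `|b|) => // [{}x y|{}x|{}x Mx].
    + by rewrite cmulBl.
    + by rewrite mulrC norm_cmul.
    + exact: (alg_mulr aX).
have cle : ~ cl e.
  move=> /(_ 2^-1)[|x Mx /ltW ex]; first by rewrite invr_gt0.
  exact: Xe (unit_mod_far aX ueM Mx ex).
have clM := Mmax _ acl Mcl cle.
have iM : ideal setT M.
  by apply: alg_ideal_closed => //; apply/closed_normP => x; rewrite -{2}clM.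
exists M; split => //; split.
  by split => //; apply/(quotient_unitalP iM); exists e.
split=> // [MT|J iJ MJ JT]; first by apply: Xe; rewrite -/M MT.
apply: Mmax => //; first exact: ideal_alg.
move=> Je; apply: JT; apply: (@unit_mod_full _ _ e iJ) => // b _.
by have [h1 h2] := ueM b Logic.I; split; exact: MJ.
Qed.

Lemma preimage_mul_closed I e : closed I -> closed [set a | I (e ** a)].
Proof.
move=> cI; apply/closed_normP => a H; apply: (closed_normP I).1 => // d d0.
have e1 : 0 < `|e| + 1 by rewrite ltr_wpDl.
have [b Jb ab] := H (d / (`|e| + 1)) (divr_gt0 d0 e1).
exists (e ** b) => //; rewrite -cmulBr (le_lt_trans (norm_cmul _ _)) //.
rewrite (@le_lt_trans _ _ ((`|e| + 1) * `|a - b|)) //.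
  by rewrite ler_wpM2r // lerDl.
by rewrite mulrC -ltr_pdivlMr.
Qed.

(** As x is central, the a with xa in M form an ideal above M. If it is M, then y is in M; if it is
    A, then xe is in M and so is x. *)
Lemma Max_central_prime M : Max setT M -> central_prime M.
Proof.
move=> mM x y hx Mxy; have iM := MaxT_ideal mM; have [e ue Me] := MaxT_unit mM.
pose J := [set a | M (x ** a)].
have iJ : ideal setT J.
  apply: alg_ideal_closed; last first.
    by apply: preimage_mul_closed; exact: (ideal_closed iM).
  split; rewrite /J /=.
  - by rewrite cmulx0; exact: (ideal0 iM).
  - by move=> a b h1 h2; rewrite cmulDr; exact: (idealD iM).
  - by move=> k a h1; rewrite cmulZr; exact: (idealZ iM).
  - by move=> b a h1; rewrite cmulA hx -cmulA; exact: (ideal_mull iM).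
  - by move=> a b h1; rewrite cmulA; exact: (ideal_mulr iM).
have [|JM|JT] := MaxT_maximal mM iJ.
- by move=> a Ma; exact: (ideal_mull iM).
- by right; rewrite -JM.
left; apply: (unit_mod_mem iM ue) => //; rewrite -hx.
by have : J e by rewrite JT.
Qed.

(** The algebraic sum L = I + M contains e, since otherwise a maximal ideal above L would equal M
    and contain I. The I-component of e is then still a unit modulo M. *)
Lemma Max_unit_in I M : Max setT M -> ideal setT I -> ~ I `<=` M ->
  exists e, [/\ I e, unit_mod setT e M & ~ M e].
Proof.
move=> mM iI IM; have iM := MaxT_ideal mM; have [e ue Me] := MaxT_unit mM.
pose L := [set a | exists2 i, I i & M (a - i)].
have aL : alg_ideal L.
  split.
  - by exists 0; [exact: (ideal0 iI)|rewrite subrr; exact: (ideal0 iM)].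
  - move=> x y [i Ii Mi] [j Ij Mj]; exists (i + j); first exact: (idealD iI).
    by rewrite opprD addrACA; exact: (idealD iM).
  - move=> k x [i Ii Mi]; exists (k *: i); first exact: (idealZ iI).
    by rewrite -scalerBr; exact: (idealZ iM).
  - move=> b x [i Ii Mi]; exists (b ** i); first exact: (ideal_mull iI).
    by rewrite -cmulBr; exact: (ideal_mull iM).
  - move=> x b [i Ii Mi]; exists (i ** b); first exact: (ideal_mulr iI).
    by rewrite -cmulBl; exact: (ideal_mulr iM).
have ML : M `<=` L.
  by move=> x Mx; exists 0; rewrite ?subr0 //; exact: (ideal0 iI).
have [[i Ii Mei]|Le] := EM (L e).
  exists i; split => // [b _|Mi].
    have [h1 h2] := ue b Logic.I.
    split.
      have -> : i ** b - b = (e ** b - b) - (e - i) ** b.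
        by rewrite cmulBl opprB [RHS]addrC subrKA.
      by apply: (idealB iM) => //; exact: (ideal_mulr iM).
    have -> : b ** i - b = (b ** e - b) - b ** (e - i).
      by rewrite cmulBr opprB [RHS]addrC subrKA.
    by apply: (idealB iM) => //; exact: (ideal_mull iM).
  by apply: Me; rewrite -(subrK i e); exact: (idealD iM).
have [|M' [mM' LM' Me']] := exists_Max aL _ Le.
  by move=> b _; have [h1 h2] := ue b Logic.I; split; exact: ML.
case: IM; have [|<-|M'T] := MaxT_maximal mM (MaxT_ideal mM').
- exact: subset_trans LM'.
- by move=> i Ii; apply: LM'; exists i => //; rewrite subrr; exact: (ideal0 iM).
by case: Me'; rewrite M'T.
Qed.

(** The unit e does the work of an approximate unit: modulo N, bx is (eb)x with eb in I, and
    symmetrically on the right. *)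
Lemma modular_ideal_trans I N e : ideal setT I -> ideal I N -> I e ->
  unit_mod I e N -> ideal setT N.
Proof.
move=> iI iN Ie ue; have NI := ideal_sub iN; apply: alg_ideal_closed; last first.
  exact: (ideal_closed iN).
split; [exact: (ideal0 iN)|exact: (idealD iN)|exact: (idealZ iN)| |].
  move=> b x Nx; apply: (unit_mod_mem iN ue); first exact: (ideal_mull iI _ (NI _ Nx)).
  by rewrite cmulA; apply: (ideal_mull iN) => //; exact: (ideal_mulr iI).
move=> x b Nx.
have Ixb : I (x ** b) by apply: (ideal_mulr iI) => //; exact: NI.
have [_ h] := ue _ Ixb; rewrite -[x ** b](subKr (x ** b ** e)).
apply: (idealB iN) => //; rewrite -cmulA; apply: (ideal_mulr iN) => //.
exact: (ideal_mull iI).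
Qed.

(** This is the candidate for the ideal of A that extends N. Left stability holds because (eb)e is
    eb modulo N, so e(ba) is (eb)(ea) modulo N. *)
Lemma colon_ideal I N e : ideal setT I -> ideal setT N -> I e ->
  unit_mod I e N -> ideal setT [set a | N (e ** a)].
Proof.
move=> iI iN Ie ue; apply: alg_ideal_closed; last first.
  by apply: preimage_mul_closed; exact: (ideal_closed iN).
split => /=.
- by rewrite cmulx0; exact: (ideal0 iN).
- by move=> a b h1 h2; rewrite cmulDr; exact: (idealD iN).
- by move=> k a h1; rewrite cmulZr; exact: (idealZ iN).
- move=> b a h1; have Ieb : I (e ** b) by exact: (ideal_mulr iI).
  have [_ h] := ue _ Ieb.
  have -> : e ** (b ** a) = e ** b ** (e ** a) - (e ** b ** e - e ** b) ** a.
    by rewrite cmulBl opprB -!cmulA [RHS]addrC subrK.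
  by apply: (idealB iN); [exact: (ideal_mull iN)|exact: (ideal_mulr iN)].
- by move=> a b h1; rewrite cmulA; exact: (ideal_mulr iN).
Qed.

Lemma ideal_restrict J I : ideal setT J -> ideal setT I -> ideal I (J `&` I).
Proof.
move=> iJ iI.
split=> [x [] //||x y [Jx Ix] [Jy Iy]|k x [Jx Ix]|b x Ib [Jx Ix]|x b [Jx Ix] Ib|].
- by split; [exact: (ideal0 iJ)|exact: (ideal0 iI)].
- by split; [exact: (idealD iJ)|exact: (idealD iI)].
- by split; [exact: (idealZ iJ)|exact: (idealZ iI)].
- by split; [exact: (ideal_mull iJ)|exact: (ideal_mull iI)].
- by split; [exact: (ideal_mulr iJ)|exact: (ideal_mulr iI)].
- by apply: closedI; [exact: (ideal_closed iJ)|exact: (ideal_closed iI)].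
Qed.

(** If J lies between the trace of M and I, the ideal of all a with ea in J contains M. If it is M,
    then J is the trace; if it is A, then e is in J and J = I. *)
Lemma Max_restrict I M : Max setT M -> ideal setT I -> ~ I `<=` M ->
  Max I (M `&` I).
Proof.
move=> mM iI IM; have iM := MaxT_ideal mM.
have [e [Ie ue Me]] := Max_unit_in mM iI IM.
have iMI := ideal_restrict iM iI.
have ueI : unit_mod I e (M `&` I).
  move=> b Ib; have [h1 h2] := ue b Logic.I.
  by split; split => //; apply: (idealB iI) => //; exact: (ideal_mull iI).
split.
  by split => //; apply/(quotient_unitalP iMI); exists e.
split => // [E|J iJ MJ JI].
  by apply: Me; have [] : (M `&` I) e by rewrite E.
have ueJ : unit_mod I e J by move=> b /ueI[h1 h2]; split; exact: MJ.
have iJ' := modular_ideal_trans iI iJ Ie ueJ.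
have iC := colon_ideal iI iJ' Ie ueJ.
apply/seteqP; split => //.
have [|CM|CT] := MaxT_maximal mM iC.
- by move=> a Ma; apply: MJ; split; [exact: (ideal_mull iM)|exact: (ideal_mulr iI)].
- move=> j Jj; split; last exact: (ideal_sub iJ).
  by rewrite -CM /=; exact: (ideal_mull iJ').
case: JI; apply: (unit_mod_full iJ ueJ) => //; apply: (unit_mod_mem iJ ueJ) => //.
by have : [set a | J (e ** a)] e by rewrite CT.
Qed.

(** M consists of the a with ea in N. A proper ideal J above M has trace N on I by maximality of N,
    so a in J gives ea in N, that is, a in M. *)
Lemma Max_extend I N : ideal setT I -> Max I N ->
  exists M, [/\ Max setT M, M `&` I = N & ~ I `<=` M].
Proof.
move=> iI [[iN /(quotient_unitalP iN)[e Ie ue]] [_ NI Nmax]].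
have iN' := modular_ideal_trans iI iN Ie ue.
have iM := colon_ideal iI iN' Ie ue; set M := [set a | _] in iM.
have Ne : ~ N e by move=> h; apply: NI; exact: (unit_mod_full iN ue).
have MI : M `&` I = N.
  apply/seteqP; split=> [a [Ma Ia]|a Na]; first exact: (unit_mod_mem iN ue).
  by split; [exact: (ideal_mull iN')|exact: (ideal_sub iN)].
have ueM : unit_mod setT e M.
  move=> b _; rewrite /M /= !cmulBr !cmulA.
  have Ieb : I (e ** b) by exact: (ideal_mulr iI).
  have [_ h] := ue _ Ieb; split => //.
  have [h' _] := ue _ Ie; rewrite -cmulBl; exact: (ideal_mulr iN').
exists M; split => //; last first.
  by move=> IM; apply: Ne; rewrite -MI; split => //; exact: IM.
split.
  by split => //; apply/(quotient_unitalP iM); exists e.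
split=> // [MT|J iJ MJ JT].
  by apply: Ne; rewrite -MI MT; split.
have ueJ : unit_mod setT e J by move=> b /ueM[h1 h2]; split; exact: MJ.
have iJI := ideal_restrict iJ iI.
have JN : J `&` I = N.
  apply: Nmax => //; first by rewrite -MI => a [Ma Ia]; split => //; exact: MJ.
  move=> E; apply: JT; apply: (unit_mod_full iJ ueJ) => //.
  by have [] : (J `&` I) e by rewrite E.
apply/seteqP; split => // a Ja; rewrite /M /= -JN; split.
  exact: (ideal_mull iJ).
exact: (ideal_mulr iI).
Qed.

(** For z in Z(I), the commutator y of z and a lies in I and satisfies yI = 0, since z commutes with
    both x and ax for x in I. Then y y*y = 0, which forces y = 0 by the C*-identity. *)
Lemma center_of_ideal I : ideal setT I -> center I = center setT `&` I.
Proof.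
move=> iI; apply/seteqP; split=> [z [Iz hz]|z [/centerT hz Iz]]; last by split.
split => //; apply/centerT => a; apply/eqP; rewrite -subr_eq0.
set y := z ** a - a ** z.
have Iy : I y by apply: (idealB iI); [exact: (ideal_mulr iI)|exact: (ideal_mull iI)].
have yI x : I x -> y ** x = 0.
  move=> Ix; rewrite cmulBl -!cmulA (hz x Ix) (hz (a ** x)) ?cmulA ?subrr //.
  exact: (ideal_mull iI).
have : y ** (adj y ** y) = 0 by apply: yI; exact: (ideal_mull iI).
move/(congr1 (cmul (adj y))); rewrite cmulx0 cmulA => E.
have := cstar_identity (adj y ** y); rewrite adjM adjK E normr0.
by move/esym/eqP; rewrite expf_eq0 /= cstar_identity expf_eq0 /= normr_eq0.
Qed.

(** With e in I a unit modulo M1, a in M2 gives ea in the common trace, hence a in M1; maximality of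
    M2 finishes. *)
Lemma Max_restrict_inj I M1 M2 : ideal setT I -> Max setT M1 -> Max setT M2 ->
  ~ I `<=` M1 -> M1 `&` I = M2 `&` I -> M1 = M2.
Proof.
move=> iI m1 m2 IM E; have [e [Ie ue Me]] := Max_unit_in m1 iI IM.
have i1 := MaxT_ideal m1; have i2 := MaxT_ideal m2.
have [|//|M1T] := MaxT_maximal m2 i1; last by case: Me; rewrite M1T.
move=> a Ma; apply: (unit_mod_mem i1 ue) => //.
suff : (M1 `&` I) (e ** a) by case.
by rewrite E; split; [exact: (ideal_mull i2)|exact: (ideal_mulr iI)].
Qed.

End MaximalIdeals.

(** * The kernel of T_A: weak centrality and maximality *)

Section KernelTA.
Context {R : realType} {A : cstarAlgType R}.
Implicit Types (z e s : A) (M I J : set A).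

Lemma ker_TA_ideal : ideal setT (ker_TA A).
Proof.
have iT M : TA A M -> ideal setT M by case=> [[]|[]] /MaxT_ideal.
split=> // [M /iT iM|x y hx hy M MT|k x hx M MT|b x _ hx M MT|x b hx _ M MT|].
- exact: (ideal0 iM).
- by apply: (idealD (iT _ MT)); [exact: hx|exact: hy].
- by apply: (idealZ (iT _ MT)); exact: hx.
- by apply: (ideal_mull (iT _ MT)) => //; exact: hx.
- by apply: (ideal_mulr (iT _ MT)) => //; exact: hx.
- by apply: closed_bigI => M /iT iM; exact: (ideal_closed iM).
Qed.

Lemma localization_alg_ideal J M : ideal setT J -> central_prime M ->
  ~ center setT `<=` M ->
  alg_ideal [set a : A | exists s, [/\ central s, ~ M s & J (s ** a)]].
Proof.
move=> iJ pM /nonsubset[z [/centerT hz Mz]]; split => /=.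
- by exists z; rewrite cmulx0; split => //; exact: (ideal0 iJ).
- move=> x y [s [hs Ms Js]] [t [ht Mt Jt]]; exists (s ** t); split.
  + exact: centralM.
  + by move=> /pM[].
  rewrite cmulDr; apply: (idealD iJ); last by rewrite -cmulA; exact: (ideal_mull iJ).
  by rewrite hs -cmulA; exact: (ideal_mull iJ).
- move=> k x [s [hs Ms Js]]; exists s; split => //.
  by rewrite cmulZr; exact: (idealZ iJ).
- move=> b x [s [hs Ms Js]]; exists s; split => //.
  by rewrite cmulA hs -cmulA; exact: (ideal_mull iJ).
- move=> x b [s [hs Ms Js]]; exists s; split => //.
  by rewrite cmulA; exact: (ideal_mulr iJ).
Qed.

Lemma exists_Max_above J M : ideal setT J -> Max setT M ->
  ~ center setT `<=` M -> center setT `&` J `<=` M ->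
  exists M', [/\ Max setT M', J `<=` M', ~ center setT `<=` M' &
                 M `&` center setT = M' `&` center setT].
Proof.
move=> iJ mM ZM ZJM; have iM := MaxT_ideal mM; have pM := Max_central_prime mM.
have [e [s [he hs Ms es]]] := local_unit iM pM ZM.
have aL := localization_alg_ideal iJ pM ZM; set L := [set a | _] in aL.
have ueL : unit_mod setT e L.
  move=> b _; split; exists s; split => //.
    by rewrite cmulBr cmulA -he es subrr; exact: (ideal0 iJ).
  by rewrite cmulBr -(he b) cmulA -he es subrr; exact: (ideal0 iJ).
(* If te is in J, it is central and so lies in M; then t or e is in M, and e in M would put s = es
   in M. *)
have Le : ~ L e.
  move=> [t [ht Mt Jt]]; have /ZJM/pM[//|//|Me] : (center setT `&` J) (t ** e).
    by split => //; apply/centerT; exact: centralM.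
  by apply: Ms; rewrite -es; exact: (ideal_mulr iM).
have [M' [mM' LM' Me']] := exists_Max aL ueL Le.
have iM' := MaxT_ideal mM'; have pM' := Max_central_prime mM'.
have ann z t : central z -> central t -> ~ M t -> t ** z = 0 -> M' z.
  by move=> hz ht Mt tz; apply: LM'; exists t; rewrite tz; split => //; exact: (ideal0 iJ).
have ZM' : ~ center setT `<=` M' by move=> H; apply: Me'; apply: H; apply/centerT.
have MM' := local_ideal_sub iM iM' pM' ZM ann.
(* [local_ideal_sub] with the roles exchanged: if tz = 0 with t central outside M', then t is
   outside M by [MM'], so z is in M. *)
have M'M : M' `&` center setT `<=` M.
  apply: local_ideal_sub => // z t hz ht Mt tz.
  have /pM[] // : M (t ** z) by rewrite tz; exact: (ideal0 iM).
  by move=> Mt'; case: Mt; apply: MM'; split => //; apply/centerT.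
exists M'; split => //.
  by move=> x Jx; apply: LM'; exists s; split => //; exact: (ideal_mull iJ).
apply/seteqP; split=> x [h1 h2]; split => //; [exact: MM'|exact: M'M].
Qed.

(** Otherwise [exists_Max_above] yields M' containing ker T_A with the same trace as M on Z(A). M'
    differs from M, so M is in T_A and contains ker T_A. *)
Lemma center_ker_TA_notin M : Max setT M -> ~ ker_TA A `<=` M ->
  ~ center setT `&` ker_TA A `<=` M.
Proof.
move=> mM kM ZkM; have kT : ~ TA A M by move=> TM; apply: kM => x; apply.
have ZM : ~ center setT `<=` M by move=> ZM; apply: kT; left.
have [M' [mM' kM' ZM' E]] := exists_Max_above ker_TA_ideal mM ZM ZkM.
apply: kT; right; split => //; exists M'; split => //; split => // MM'.
by apply: kM; rewrite MM'.
Qed.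

Lemma ker_TA_weakly_central : weakly_central (ker_TA A).
Proof.
have iK := ker_TA_ideal; split=> [N mN|N1 N2 mN1 mN2].
  have [M [mM <- kM]] := Max_extend iK mN; rewrite center_of_ideal // => H.
  by apply: (center_ker_TA_notin mM kM) => x /H[].
have [M1 [m1 <- k1]] := Max_extend iK mN1; have [M2 [m2 <- k2]] := Max_extend iK mN2.
rewrite center_of_ideal // => E; congr (_ `&` _).
have /nonsubset[j [[/centerT hj kj] M1j]] := center_ker_TA_notin m1 k1.
have EP z : central z -> ker_TA A z -> M1 z <-> M2 z.
  move=> hz kz; have zZ : center setT z by apply/centerT.
  split=> Mz.
    have : (M1 `&` ker_TA A `&` (center setT `&` ker_TA A)) z by [].
    by rewrite E => -[[]].
  have : (M2 `&` ker_TA A `&` (center setT `&` ker_TA A)) z by [].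
  by rewrite -E => -[[]].
(* Multiplying by j extends the agreement from Z(A) [&] ker T_A to Z(A): j is outside both M1 and
   M2, so z is in either ideal exactly when jz is. *)
have EZ z : central z -> M1 z <-> M2 z.
  move=> hz; have kjz : ker_TA A (j ** z) by exact: (ideal_mulr iK).
  have := EP _ (centralM hj hz) kjz; have := EP _ hj kj.
  have := @ideal_mull _ _ _ _ (MaxT_ideal m1) j z Logic.I.
  have := @ideal_mull _ _ _ _ (MaxT_ideal m2) j z Logic.I.
  have := @Max_central_prime _ _ _ m1 j z hj.
  have := @Max_central_prime _ _ _ m2 j z hj.
  by have {}M1j : ~ M1 j := M1j; tauto.
apply: contrapT => M12; apply: (k1) => x; apply; right; split => //.
exists M2; split => //; split => //.
- by move=> ZM; apply: (center_ker_TA_notin m1 k1) => y [Zy _]; exact: ZM.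
- by move=> ZM; apply: (center_ker_TA_notin m2 k2) => y [Zy _]; exact: ZM.
by apply/seteqP; split=> z [h /[dup] hz /centerT /EZ[h1 h2]]; split; auto.
Qed.

(** Suppose M in T_A does not contain I. If M contains Z(A), its trace on I violates (a). Otherwise
    its partner N cannot contain I, again by (a); the traces of M and N on Z(I) agree, so (b) and
    [Max_restrict_inj] give M = N. *)
Lemma weakly_central_sub_ker_TA I : weakly_central_ideal I -> I `<=` ker_TA A.
Proof.
move=> [iI [wa wb]] x Ix M; apply: contraPP => Mx TM.
have mM : Max setT M by case: TM => [[]|[]].
have IM : ~ I `<=` M by move=> H; apply: Mx; exact: H.
have mMI := Max_restrict mM iI IM.
case: TM => [[_ ZM]|[_ [N [mN [MN ZM ZN E]]]]].
  by apply: (wa _ mMI); rewrite center_of_ideal // => z [/ZM Mz Iz].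
have ZIM : ~ center setT `&` I `<=` M.
  by move=> H; apply: (wa _ mMI); rewrite center_of_ideal // => z [Zz Iz]; split => //; exact: H.
have IN : ~ I `<=` N.
  move=> IN; apply: ZIM => z [Zz Iz].
  have : (N `&` center setT) z by split => //; exact: IN.
  by rewrite -E => -[].
apply: MN; apply: (Max_restrict_inj iI mM mN IM).
apply: wb => //; first exact: Max_restrict.
rewrite center_of_ideal //; apply/seteqP; split=> z [[h1 h2] [h3 h4]]; split => //; split => //.
  by have [] : (N `&` center setT) z by rewrite -E.
by have [] : (M `&` center setT) z by rewrite E.
Qed.

End KernelTA.

Theorem theorem3p22 (R : realType) (A : cstarAlgType R) :
  weakly_central_ideal (ker_TA A) /\
  (forall I : set A, weakly_central_ideal I -> I `<=` ker_TA A).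
Proof.
split; last exact: weakly_central_sub_ker_TA.
by split; [exact: ker_TA_ideal|exact: ker_TA_weakly_central].
Qed.
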